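(* Fix $\eta\in(0,1)$. Let $f:[0,1]^2\to[0,1]$ be a graphon, i.e. a measurable function with $f(x,y)=f(y,x)$ for all $x,y$. For each $n\ge1$ let $U_1,\dots,U_n$ be i.i.d. uniform random variables on $[0,1]$; given these, let a random undirected graph on vertices $1,\dots,n$ be formed by putting an edge between $i$ and $j$ with probability $f(U_i,U_j)$, independently for all $1\le i<j\le n$. Let $M$ be the (random) $n\times n$ matrix whose $(i,j)$th element is $f(U_i,U_j)$, and let $\hat M$ be the USVT estimator with tuning parameter $\eta$ computed from the fully observed adjacency matrix $X$ of the graph. Then $$\operatorname{MSE}(\hat M)\le C(f,n),$$ where $C(f,n)$ is a constant depending only on $f$, $n$ and $\eta$ such that $\lim_{n\to\infty}C(f,n)=0$.
   Context: $X$ is the symmetric $\{0,1\}$-valued adjacency matrix with zero diagonal. $\operatorname{MSE}(\hat M):=\mathbb{E}\big[\frac1{n^2}\sum_{i,j=1}^n(\hat m_{ij}-m_{ij})^2\big]$, where the expectation is over both the randomness of the $U_i$'s (hence of $M$) and that of the graph. USVT estimator with tuning parameter $\eta\in(0,1)$ (fully observed case): let $X=\sum_{i=1}^n s_iu_iv_i^T$ be the singular value decomposition of $X$, $S:=\{i:s_i\ge(2+\eta)\sqrt n\}$, $W:=\sum_{i\in S}s_iu_iv_i^T$, and let $\hat m_{ij}$ be the truncation of $w_{ij}$ to $[-1,1]$ ($\hat m_{ij}=w_{ij}$ if $|w_{ij}|\le1$, $1$ if $w_{ij}>1$, $-1$ if $w_{ij}<-1$). *)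

(* Defs.v *)
From HB Require Import structures.
From mathcomp Require Import all_boot all_order all_algebra.
From mathcomp Require Import all_classical all_reals all_analysis.
Set Implicit Arguments.
Unset Strict Implicit.
Unset Printing Implicit Defensive.
Import Order.TTheory GRing.Theory Num.Theory.
Import numFieldNormedType.Exports.
Local Open Scope classical_set_scope.
Local Open Scope ring_scope.

(* Measurability is Borel measurability; the values of [f] outside the unit
   square are unconstrained. *)
Definition graphon (R : realType) (f : R * R -> R) : Prop :=
  [/\ measurable_fun (`[0, 1] `*` `[0, 1] : set (R * R)) f,
      forall x y : R, x \in `[0, 1] -> y \in `[0, 1] -> 0 <= f (x, y) <= 1
    & forall x y : R, x \in `[0, 1] -> y \in `[0, 1] -> f (x, y) = f (y, x)].

(* The full-family product rule gives that of every subfamily: take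
   [A i := setT] for the indices to be dropped. *)
Definition mutually_independent (R : realType) (d : measure_display)
    (T : measurableType d) (P : probability T R) (n : nat)
    (U : 'I_n -> {RV P >-> R}) : Prop :=
  forall A : 'I_n -> set R, (forall i, measurable (A i)) ->
    (P (\bigcap_i (U i @^-1` A i)) = \prod_(i < n) P (U i @^-1` A i))%E.

Definition iid_uniform (R : realType) (d : measure_display)
    (T : measurableType d) (P : probability T R) (n : nat)
    (U : 'I_n -> {RV P >-> R}) : Prop :=
  [/\ forall i w, U i w \in `[0, 1],
      forall i (A : set R), measurable A ->
        distribution P (U i) A = uniform_prob (@ltr01 R) A
    & mutually_independent U].

Definition adjacency_matrix (R : realType) (n : nat) (A : 'M[R]_n) : Prop :=
  [/\ forall i j, A i j = 0 \/ A i j = 1,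
      forall i j, A i j = A j i
    & forall i, A i i = 0].

Definition mean_matrix (R : realType) (T : Type) (f : R * R -> R) (n : nat)
    (U : 'I_n -> T -> R) (w : T) : 'M[R]_n :=
  \matrix_(i, j) f (U i w, U j w).

(* The last clause says that, conditionally on the sigma-algebra generated by
   the U_i, the edge indicators X_ij (i < j) are independent Bernoulli variables
   with parameters f(U_i, U_j): the product of Bernoulli mass functions is a
   version of the conditional probability of each edge pattern [a]. *)
Definition graphon_random_graph (R : realType) (d : measure_display)
    (T : measurableType d) (P : probability T R) (f : R * R -> R) (n : nat)
    (U : 'I_n -> {RV P >-> R}) (X : T -> 'M[R]_n) : Prop :=
  [/\ forall w, adjacency_matrix (X w),
      forall i j, measurable_fun setT (fun w => X w i j)
    & forall (a : 'I_n -> 'I_n -> bool) (B : set T),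
        g_sigma_preimage (fun i => U i : T -> R) B ->
        (P (B `&` [set w | forall i j : 'I_n, (i < j)%N ->
                             X w i j = (a i j)%:R]) =
         \int[P]_(w in B)
           (\prod_(i < n) \prod_(j < n | (i < j)%N)
              (if a i j then f (U i w, U j w)
               else 1 - f (U i w, U j w)))%R%:E)%E].

(* The i-th left and right singular vectors are the i-th columns of [U], [V]. *)
Definition is_svd (R : realType) (n : nat) (A : 'M[R]_n)
    (s : 'I_n -> R) (U V : 'M[R]_n) : Prop :=
  [/\ forall i, 0 <= s i,
      U^T *m U = 1%:M,
      V^T *m V = 1%:M
    & A = \sum_(i < n) s i *: (col i U *m (col i V)^T)].

Definition truncate (R : realType) (x : R) : R :=
  if 1 < x then 1 else if x < -1 then -1 else x.

Definition is_usvt (R : realType) (n : nat) (eta : R)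
    (A Mhat : 'M[R]_n) : Prop :=
  exists (s : 'I_n -> R) (U V : 'M[R]_n),
    is_svd A s U V /\
    Mhat = map_mx (@truncate R)
      (\sum_(i < n | (2 + eta) * Num.sqrt n%:R <= s i)
         s i *: (col i U *m (col i V)^T)).

(* The matrix produced by [is_usvt] exists and does not depend on the choice of
   the singular value decomposition, so this determines [usvt]. *)
Definition usvt_estimator (R : realType) (n : nat) (eta : R)
    (usvt : 'M[R]_n -> 'M[R]_n) : Prop :=
  forall A, is_usvt eta A (usvt A).

Definition MSE (R : realType) (d : measure_display) (T : measurableType d)
    (P : probability T R) (n : nat) (Mhat M : T -> 'M[R]_n) : \bar R :=
  ('E_P[fun w => ((n%:R ^+ 2)^-1 *
     \sum_(i < n) \sum_(j < n) (Mhat w i j - M w i j) ^+ 2)%R])%E.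

(* Main.v *)
(* The estimator thresholds the singular values of X at t = (2 + eta) sqrt n. If
   the noise X - M has operator norm at most b < t and B is any matrix, the
   singular values kept by the threshold number at most
     |M - B|_F^2 / (t - b)^2 + 2 |B|_* / (t - b),
   and this controls |W - M|_F^2 by |M - B|_F^2 and the nuclear norm |B|_*.

   One may take b = 2 sqrt n + 1 outside an event of exponentially small
   probability: if the noise (without its diagonal) has norm above 2 sqrt n, its
   top eigenvector, scaled to norm 2 sqrt n and rounded to integers, gives a
   lattice vector z with |z' (X - M) z| >= 2 sqrt n (|z|^2 - n/2). Hoeffding's
   bound with variance proxy 1/4 per edge makes each z so unlikely that the union
   over all lattice vectors is at most 2 (199/200)^n.

   For B take g(U_i, U_j), where g is a finite combination of indicators of
   rectangles that approximates f in L^2. Then |B|_* <= K n with K independent of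
   n, and the expectation of |M - B|_F^2 / n^2 is at most |f - g|_2^2 + O(1/n). *)

Require Import Defs.
From HB Require Import structures.
From mathcomp Require Import all_boot all_order all_algebra.
From mathcomp Require Import all_classical all_reals all_analysis.
From mathcomp Require Import measurable_realfun ring lra zify.
Set Implicit Arguments.
Unset Strict Implicit.
Unset Printing Implicit Defensive.
Import Order.TTheory GRing.Theory Num.Theory.
Import numFieldNormedType.Exports.
Local Open Scope classical_set_scope.
Local Open Scope ring_scope.

(** * Operator and nuclear norm bounds, and the thresholding inequality *)

Section Frobenius.
Variable R : realFieldType.

Definition fdot m n (A B : 'M[R]_(m, n)) : R := \sum_i \sum_j A i j * B i j.

Lemma fdotE m n (A B : 'M[R]_(m, n)) : fdot A B = \tr (A^T *m B).
Proof.
rewrite /fdot exchange_big /= /mxtrace; apply: eq_bigr => j _.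
by rewrite mxE; apply: eq_bigr => i _; rewrite mxE.
Qed.

Lemma fdotC m n (A B : 'M[R]_(m, n)) : fdot A B = fdot B A.
Proof. by apply: eq_bigr => i _; apply: eq_bigr => j _; rewrite mulrC. Qed.

Lemma fdotDr m n (A B C : 'M[R]_(m, n)) : fdot A (B + C) = fdot A B + fdot A C.
Proof. by rewrite !fdotE mulmxDr raddfD. Qed.

Lemma fdotDl m n (A B C : 'M[R]_(m, n)) : fdot (B + C) A = fdot B A + fdot C A.
Proof. by rewrite fdotC fdotDr !(fdotC A). Qed.

Lemma fdotZr m n c (A B : 'M[R]_(m, n)) : fdot A (c *: B) = c * fdot A B.
Proof. by rewrite !fdotE -scalemxAr mxtraceZ. Qed.

Lemma fdotZl m n c (A B : 'M[R]_(m, n)) : fdot (c *: A) B = c * fdot A B.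
Proof. by rewrite fdotC fdotZr fdotC. Qed.

Lemma fdotNr m n (A B : 'M[R]_(m, n)) : fdot A (- B) = - fdot A B.
Proof. by rewrite -scaleN1r fdotZr mulN1r. Qed.

Lemma fdotNl m n (A B : 'M[R]_(m, n)) : fdot (- A) B = - fdot A B.
Proof. by rewrite fdotC fdotNr fdotC. Qed.

Lemma fdotBr m n (A B C : 'M[R]_(m, n)) : fdot A (B - C) = fdot A B - fdot A C.
Proof. by rewrite fdotDr fdotNr. Qed.

Lemma fdotBl m n (A B C : 'M[R]_(m, n)) : fdot (B - C) A = fdot B A - fdot C A.
Proof. by rewrite fdotDl fdotNl. Qed.

Lemma fdot_ge0 m n (A : 'M[R]_(m, n)) : 0 <= fdot A A.
Proof. by do 2![apply: sumr_ge0 => ? _]; rewrite -expr2 sqr_ge0. Qed.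

Lemma fdot_eq0 m n (A : 'M[R]_(m, n)) : (fdot A A == 0) = (A == 0).
Proof.
apply/eqP/eqP => [A0|->]; last first.
  by rewrite /fdot big1// => i _; rewrite big1// => j _; rewrite mxE mul0r.
apply/matrixP => i j; rewrite mxE; apply/eqP; rewrite -sqrf_eq0 expr2.
have sq_ge0 k l : 0 <= A k l * A k l by rewrite -expr2 sqr_ge0.
have /(_ i isT)/psumr_eq0P := psumr_eq0P (fun i _ => sumr_ge0 _ (fun j _ => sq_ge0 i j)) A0.
by move=> ->//.
Qed.

Lemma fdot_mull m n p (C : 'M[R]_(m, p)) (A : 'M[R]_(p, n)) (B : 'M[R]_(m, n)) :
  fdot (C *m A) B = fdot A (C^T *m B).
Proof. by rewrite !fdotE trmx_mul mulmxA. Qed.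

Lemma fdot_mulr m n p (A : 'M[R]_(m, p)) (C : 'M[R]_(p, n)) (B : 'M[R]_(m, n)) :
  fdot (A *m C) B = fdot A (B *m C^T).
Proof. by rewrite !fdotE trmx_mul -mulmxA mxtrace_mulC mulmxA. Qed.

(** Expand [0 <= |c A - B|^2] and divide by [2 c]. *)
Lemma fdot_young m n c (A B : 'M[R]_(m, n)) :
  0 < c -> fdot A B <= c * fdot A A / 2 + fdot B B / (2 * c).
Proof.
move=> c0; have := fdot_ge0 (c *: A - B).
rewrite fdotBr !fdotBl !fdotZl !fdotZr (fdotC B A) => h.
rewrite -(ler_pM2l c0) -subr_ge0.
have -> : c * (c * fdot A A / 2 + fdot B B / (2 * c)) - c * fdot A B =
  (c * (c * fdot A A) - c * fdot A B - (c * fdot A B - fdot B B)) / 2.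
  by field; rewrite gt_eqF.
by rewrite divr_ge0// ler0n.
Qed.

Lemma fdot_isom m n p (U : 'M[R]_(m, p)) (A B : 'M[R]_(p, n)) :
  U^T *m U = 1%:M -> fdot (U *m A) (U *m B) = fdot A B.
Proof. by move=> UU; rewrite fdot_mull mulmxA UU mul1mx. Qed.

Lemma fdot_diag n (d : 'rV[R]_n) (a b : 'cV[R]_n) :
  fdot a (diag_mx d *m b) = \sum_i d 0 i * (a i 0 * b i 0).
Proof.
apply: eq_bigr => i _; rewrite big_ord1 mul_diag_mx mxE; ring.
Qed.

Lemma fdot_vec n (a b : 'cV[R]_n) : fdot a b = \sum_i a i 0 * b i 0.
Proof. by apply: eq_bigr => i _; rewrite big_ord1. Qed.

(* By AM-GM and rescaling, this says that the operator norm of [A] is at most [b]. *)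
Definition op_bound n (A : 'M[R]_n) (b : R) :=
  forall u v : 'cV[R]_n, fdot u (A *m v) <= b * (fdot u u + fdot v v) / 2.

(* By duality, this says that the nuclear norm of [B] is at most [k]. *)
Definition nuclear_bound n (B : 'M[R]_n) (k : R) :=
  forall Y b, op_bound Y b -> fdot Y B <= k * b.

Lemma op_boundD n (A B : 'M[R]_n) a b :
  op_bound A a -> op_bound B b -> op_bound (A + B) (a + b).
Proof.
move=> hA hB u v; rewrite mulmxDl fdotDr; have := hA u v; have := hB u v; lra.
Qed.

Lemma op_boundN n (A : 'M[R]_n) a : op_bound A a -> op_bound (- A) a.
Proof.
move=> hA u v; have := hA (- u) v.
by rewrite mulNmx fdotNr fdotNl [fdot (- u) _]fdotNl fdotNr opprK.
Qed.

Lemma op_bound_le n (A : 'M[R]_n) a b : a <= b -> op_bound A a -> op_bound A b.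
Proof.
move=> ab hA u v; apply: le_trans (hA u v) _.
by rewrite ler_pM2r ?invr_gt0// ler_wpM2r// addr_ge0// fdot_ge0.
Qed.

Lemma op_bound_diag n (d : 'rV[R]_n) b :
  0 <= b -> (forall i, `|d 0 i| <= b) -> op_bound (diag_mx d) b.
Proof.
move=> b0 db u v; rewrite fdot_diag !fdot_vec -big_split mulr_sumr mulr_suml /=.
apply: ler_sum => i _; apply: le_trans (ler_norm _) _; rewrite normrM.
apply: (@le_trans _ _ (b * `|u i 0 * v i 0|)).
  by rewrite ler_wpM2r.
rewrite -mulrA ler_wpM2l// normrM ler_pdivlMr//.
rewrite -[u i 0 * u i 0]expr2 -[v i 0 * v i 0]expr2.
rewrite -(real_normK (num_real (u i 0))) -(real_normK (num_real (v i 0))).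
have := sqr_ge0 (`|u i 0| - `|v i 0|); rewrite !expr2; lra.
Qed.

(** Stated for contractions, so that it covers orthogonal factors as well as the projection onto the
    discarded singular directions. *)
Lemma op_bound_mul n (U V A : 'M[R]_n) b : 0 <= b ->
  (forall u : 'cV[R]_n, fdot (U^T *m u) (U^T *m u) <= fdot u u) ->
  (forall v : 'cV[R]_n, fdot (V *m v) (V *m v) <= fdot v v) ->
  op_bound A b -> op_bound (U *m A *m V) b.
Proof.
move=> b0 hU hV hA u v.
rewrite -!mulmxA fdotC fdot_mull fdotC.
apply: le_trans (hA _ _) _; rewrite ler_pM2r ?invr_gt0// ler_wpM2l//.
by rewrite lerD.
Qed.

Lemma orthogonal_trmx n (U : 'M[R]_n) : U^T *m U = 1%:M -> U *m U^T = 1%:M.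
Proof. exact: mulmx1C. Qed.

Lemma op_bound_orthogonal n (U V A : 'M[R]_n) b : 0 <= b ->
  U^T *m U = 1%:M -> V^T *m V = 1%:M -> op_bound A b ->
  op_bound (U *m A *m V) b.
Proof.
move=> b0 UU VV; apply: op_bound_mul => // u.
  by rewrite fdot_mull trmxK mulmxA (orthogonal_trmx UU) mul1mx.
by rewrite fdot_isom.
Qed.

(** Testing the quadratic form at [A v] and [b v] balances the AM-GM inequality and recovers the
    usual operator norm bound. *)
Lemma op_bound_vec n (A : 'M[R]_n) b (v : 'cV[R]_n) : 0 < b -> op_bound A b ->
  fdot (A *m v) (A *m v) <= b ^+ 2 * fdot v v.
Proof.
move=> b0 /(_ (A *m v) (b *: v)); rewrite -scalemxAr !fdotZr fdotZl => h.
have {h} : 2 * (b * fdot (A *m v) (A *m v)) <=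
    b * (fdot (A *m v) (A *m v) + b * (b * fdot v v)) by lra.
rewrite mulrCA ler_pM2l//; rewrite expr2; lra.
Qed.

Lemma op_bound_mx n p (A : 'M[R]_n) b (C : 'M[R]_(n, p)) : 0 < b -> op_bound A b ->
  fdot (A *m C) (A *m C) <= b ^+ 2 * fdot C C.
Proof.
move=> b0 hA; have cols m (B : 'M[R]_(m, p)) : fdot B B = \sum_j fdot (col j B) (col j B).
  rewrite /fdot exchange_big; apply: eq_bigr => j _; apply: eq_bigr => i _.
  by rewrite big_ord1 !mxE.
rewrite !cols mulr_sumr; apply: ler_sum => j _.
by rewrite !colE -mulmxA -colE op_bound_vec.
Qed.

Lemma op_bound_trmx n (A : 'M[R]_n) b : op_bound A b -> op_bound A^T b.
Proof.
by move=> hA u v; rewrite -fdot_mull fdotC addrC.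
Qed.

Lemma op_bound_entry n (A : 'M[R]_n) b i : op_bound A b -> A i i <= b.
Proof.
move/(_ (delta_mx i 0) (delta_mx i 0)).
have d1 (B : 'cV[R]_n) : fdot (delta_mx i 0) B = B i 0.
  rewrite fdot_vec (bigD1 i)//= big1 ?mxE ?eqxx ?mul1r ?addr0// => j ji.
  by rewrite mxE (negPf ji) mul0r.
rewrite !d1 -colE !mxE !eqxx /=; lra.
Qed.

(** The dimension is positive because an empty matrix satisfies the bound for every [b], negative
    ones included. *)
Lemma op_bound_ge0 n (A : 'M[R]_n.+1) b : op_bound A b -> 0 <= b.
Proof.
pose e : 'cV[R]_n.+1 := const_mx 1; have e2 : 0 < fdot e e.
  rewrite lt_neqAle fdot_ge0 eq_sym fdot_eq0 andbT; apply/eqP => /matrixP/(_ ord0 0)/eqP.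
  by rewrite !mxE oner_eq0.
have fdot0 m (v : 'cV[R]_m) : fdot v 0 = 0 by rewrite -(scale0r 0) fdotZr mul0r.
move=> /(_ e 0); rewrite mulmx0 !fdot0 addr0 => h.
have {}h : 0 <= b * fdot e e by lra.
by move: h; rewrite pmulr_lge0.
Qed.

(** * Deterministic error of singular value thresholding *)

Section Usvt.
Variables (n : nat) (s : 'I_n -> R) (U V M B : 'M[R]_n) (t b k : R).
Let X := \sum_(i < n) s i *: (col i U *m (col i V)^T).
Let W := \sum_(i < n | t <= s i) s i *: (col i U *m (col i V)^T).
Hypotheses (s_ge0 : forall i, 0 <= s i).
Hypotheses (UU : U^T *m U = 1%:M) (VV : V^T *m V = 1%:M).
Hypotheses (b_gt0 : 0 < b) (b_lt_t : b < t).
Hypotheses (hA : op_bound (X - M) b) (hB : nuclear_bound B k).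

Let D : 'M[R]_n := diag_mx (\row_i s i).
(** In singular coordinates [J] is the projection onto the directions kept by the threshold, and
    [card] is its rank. *)
Let J : 'M[R]_n := diag_mx (\row_i (t <= s i)%R%:R).
Let card : R := \sum_i (t <= s i)%R%:R.

Lemma svd_sumE (p : pred 'I_n) :
  \sum_(i < n | p i) s i *: (col i U *m (col i V)^T) =
  U *m (diag_mx (\row_i (p i)%:R) *m diag_mx (\row_i s i)) *m V^T.
Proof.
apply/matrixP => i j; rewrite summxE -mulmxA mxE big_mkcond /=.
apply: eq_bigr => k' _; rewrite -mulmxA !mul_diag_mx !mxE big_ord1 !mxE.
case: (p k') => /=; last by rewrite !mul0r mulr0.
by rewrite mul1r mulrCA.
Qed.

Let XE : X = U *m D *m V^T.
Proof.
rewrite /X (svd_sumE predT) (_ : diag_mx _ = 1%:M) ?mul1mx//.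
by apply/matrixP => i j; rewrite !mxE.
Qed.

Let WE : W = U *m (J *m D) *m V^T. Proof. exact: svd_sumE. Qed.

Let JJ : J *m J = J.
Proof.
apply/matrixP => i j; rewrite mul_diag_mx !mxE.
by case: (t <= s i); rewrite ?mul1r ?mul0r ?mul0rn.
Qed.

Let JT : J^T = J. Proof. exact: tr_diag_mx. Qed.

Let cardE : fdot J J = card.
Proof.
apply: eq_bigr => i _; rewrite (bigD1 i)//= big1 ?addr0 => [|j ji].
  by rewrite !mxE eqxx mulr1n; case: (t <= s i); rewrite ?mul1r ?mul0r.
by rewrite !mxE eq_sym (negPf ji) mul0r.
Qed.

Let fdotJ (A : 'M[R]_n) : fdot J A = \sum_i (t <= s i)%R%:R * A i i.
Proof.
apply: eq_bigr => i _; rewrite (bigD1 i)//= big1 ?addr0 => [|j ji].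
  by rewrite !mxE eqxx mulr1n.
by rewrite !mxE eq_sym (negPf ji) mul0r.
Qed.

Let orth_le (u : 'cV[R]_n) (Q : 'M[R]_n) : Q^T *m Q = 1%:M ->
  fdot (Q^T *m u) (Q^T *m u) <= fdot u u.
Proof. by move=> QQ; rewrite fdot_mull trmxK mulmxA (orthogonal_trmx QQ) mul1mx. Qed.

(** Pair everything with [Y = U J V^T], of operator norm at most 1. [X] contributes at least
    [t * card], the noise at most [b * card] and [B] at most [k]. Since [|Y|_F^2 = card], Young with
    weight [t - b] bounds the remaining pairing with [M - B] and absorbs half of
    [(t - b) * card]. *)
Let card_bound : card <= fdot (M - B) (M - B) / (t - b) ^+ 2 + 2 * k / (t - b).
Proof.
have tb : 0 < t - b by rewrite subr_gt0.
pose Y := U *m J *m V^T.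
have hY : op_bound Y 1.
  apply: op_bound_orthogonal => //; first by rewrite trmxK orthogonal_trmx.
  by apply: op_bound_diag => // i; rewrite mxE; case: (t <= s i); rewrite ?normr1 ?normr0.
have YE A : fdot Y A = fdot J (U^T *m A *m V).
  by rewrite /Y fdot_mulr trmxK fdot_mull mulmxA.
have YX : t * card <= fdot Y X.
  rewrite YE XE !mulmxA UU mul1mx -mulmxA VV mulmx1 fdotJ mulr_sumr.
  apply: ler_sum => i _; rewrite !mxE eqxx mulr1n.
  by case: (leP t (s i)); rewrite ?mul1r ?mul0r ?mulr1 ?mulr0.
have YA : fdot Y (X - M) <= b * card.
  have hA' : op_bound (U^T *m (X - M) *m V) b.
    by apply: op_bound_orthogonal; rewrite ?ltW// trmxK orthogonal_trmx.
  rewrite YE fdotJ mulr_sumr; apply: ler_sum => i _; rewrite mulrC.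
  by rewrite ler_wpM2r ?ler0n// op_bound_entry.
have YB := hB hY.
have YY : fdot Y Y = card.
  by rewrite YE /Y !mulmxA UU mul1mx -mulmxA VV mulmx1 cardE.
have YMB := fdot_young Y (M - B) tb.
rewrite YY in YMB.
have h : fdot Y X = fdot Y (X - M) + fdot Y B + fdot Y (M - B).
  by rewrite !fdotBr; ring.
have {}h : (t - b) * card / 2 <= k + fdot (M - B) (M - B) / (2 * (t - b)) by lra.
have := h; rewrite -(ler_pM2l (_ : 0 < 2 / (t - b))) ?divr_gt0//.
have -> : 2 / (t - b) * ((t - b) * card / 2) = card by field; rewrite gt_eqF.
move=> {}h; apply: le_trans h _; rewrite le_eqVlt; apply/orP; left; apply/eqP.
by field; rewrite gt_eqF.
Qed.

(** Let [P] project onto the discarded left singular vectors. [P X] has norm at most [t] and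
    [P (X - M)] at most [b], hence [P M] at most [t + b]. Then [|P M|^2 = <P M, B> + <P M, M - B>],
    where nuclear duality bounds the first term and Young with weight 1 the second. *)
Let complement_bound :
  fdot ((1%:M - J) *m U^T *m M) ((1%:M - J) *m U^T *m M) <=
  2 * k * (t + b) + fdot (M - B) (M - B).
Proof.
have t0 : 0 < t by apply: lt_trans b_gt0 b_lt_t.
set I := 1%:M - J.
have IT : I^T = I by rewrite /I linearB /= trmx1 JT.
have II : I *m I = I.
  by rewrite /I mulmxBr mulmxBl mul1mx mulmx1 mulmxBl mul1mx JJ subrr subr0.
have IE : I = diag_mx (\row_i (~~ (t <= s i)%R)%:R).
  apply/matrixP => i j; rewrite !mxE; case: (t <= s i) => /=; case: eqP => //= _; ring.
pose P := U *m I *m U^T.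
have PT : P^T = P by rewrite /P !trmx_mul IT trmxK mulmxA.
have PP : P *m P = P.
  by rewrite /P -!mulmxA (mulmxA U^T) UU mul1mx (mulmxA I I) II.
have -> : fdot (I *m U^T *m M) (I *m U^T *m M) = fdot (P *m M) (P *m M).
  by rewrite /P -!mulmxA (fdot_isom _ _ UU).
have PMM : fdot (P *m M) (P *m M) = fdot (P *m M) M.
  by rewrite fdotC fdot_mull PT mulmxA PP fdotC.
have hPX : op_bound (P *m X) t.
  rewrite XE /P -!mulmxA (mulmxA U^T) UU mul1mx (mulmxA I) mulmxA.
  apply: op_bound_orthogonal; rewrite ?ltW ?trmxK ?orthogonal_trmx//.
  rewrite IE /D mulmx_diag; apply: op_bound_diag; rewrite ?ltW// => i.
  rewrite !mxE; case: (leP t (s i)) => /= [_|/ltW st].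
    by rewrite mul0r normr0 ltW.
  by rewrite mul1r ger0_norm.
have hI (u : 'cV[R]_n) : fdot (I *m u) (I *m u) <= fdot u u.
  rewrite {2}IE IE fdot_diag fdot_vec; apply: ler_sum => i _.
  rewrite mul_diag_mx !mxE; case: (t <= s i) => /=; rewrite ?mul0r ?mul1r//.
  by rewrite -expr2 sqr_ge0.
have hPA : op_bound (P *m (X - M)) b.
  rewrite -(mulmx1 (P *m _)); apply: op_bound_mul => //; first exact: ltW.
    move=> u; rewrite PT /P -!mulmxA fdot_isom//; apply: le_trans (hI _) _; exact: orth_le.
  by move=> v; rewrite mul1mx.
have hPM : op_bound (P *m M) (t + b).
  have -> : P *m M = P *m X + - (P *m (X - M)) by rewrite mulmxBr opprB addrC subrK.
  exact/op_boundD/op_boundN.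
have h1 := hB hPM.
have := fdot_young (P *m M) (M - B) ltr01.
rewrite fdotBr mul1r mulr1 => h2.
by rewrite PMM in h2 *; lra.
Qed.

(** Pythagoras for [J] and [1 - J] in the basis [U]. On the kept directions [W] agrees with [X], so
    the error there is the noise compressed to rank [card]; on the others [W] vanishes and only [M]
    remains. *)
Lemma usvt_frobenius :
  fdot (W - M) (W - M) <=
  b ^+ 2 * (fdot (M - B) (M - B) / (t - b) ^+ 2 + 2 * k / (t - b))
  + (2 * k * (t + b) + fdot (M - B) (M - B)).
Proof.
have UT : fdot (W - M) (W - M) = fdot (U^T *m (W - M)) (U^T *m (W - M)).
  by rewrite fdot_mull trmxK mulmxA orthogonal_trmx// mul1mx.
have -> : fdot (W - M) (W - M) =
    fdot (J *m U^T *m (X - M)) (J *m U^T *m (X - M)) +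
    fdot ((1%:M - J) *m U^T *m M) ((1%:M - J) *m U^T *m M).
  have -> : J *m U^T *m (X - M) = J *m (U^T *m (W - M)).
    rewrite -mulmxA !mulmxBr; congr (_ - _).
    by rewrite WE XE -!mulmxA !(mulmxA U^T U) UU !mul1mx (mulmxA J J) JJ.
  have IW : (1%:M - J) *m (U^T *m W) = 0.
    by rewrite WE -!mulmxA (mulmxA U^T U) UU mul1mx mulmxA mulmxBl mul1mx JJ subrr mul0mx.
  rewrite UT; set Z := U^T *m (W - M).
  have -> : (1%:M - J) *m U^T *m M = - ((1%:M - J) *m Z).
    by rewrite /Z mulmxBr [_ *m (_ - _)]mulmxBr IW sub0r opprK mulmxA.
  rewrite fdotNl fdotNr opprK mulmxBl mul1mx fdotBl !fdotBr.
  rewrite !(fdotC Z) !(fdot_mull J) JT (mulmxA J) JJ; ring.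
apply: lerD complement_bound.
apply: (@le_trans _ _ (b ^+ 2 * card)); last by rewrite ler_wpM2l ?sqr_ge0.
have tr_fdot p q (A : 'M[R]_(p, q)) : fdot A A = fdot A^T A^T.
  by rewrite /fdot exchange_big; apply: eq_bigr => i _; apply: eq_bigr => j _; rewrite !mxE.
(* After transposition the noise acts on [U *m J], whose squared Frobenius norm is [card]. *)
rewrite tr_fdot -mulmxA 2!trmx_mul trmxK JT -mulmxA.
apply: le_trans (op_bound_mx _ b_gt0 (op_bound_trmx hA)) _.
by rewrite fdot_isom// cardE.
Qed.

End Usvt.
End Frobenius.

(** * The noise: Chernoff bound over a lattice net *)

(** Take logarithms: [h] vanishes at 0 together with its derivative [p + k], and its second
    derivative is [1/4 - q (1 - q) >= 0], where [q] is the exponentially tilted success probability.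
    Two applications of the mean value theorem give [h x >= 0]. *)
Lemma hoeffding_bernoulli_pos (R : realType) (p x : R) : 0 <= p <= 1 -> 0 < x ->
  p * expR (x * (1 - p)) + (1 - p) * expR (- (x * p)) <= expR (x ^+ 2 / 8).
Proof.
move=> /andP[p0 p1] x0.
pose D : R -> R := fun y => 1 - p + p * expR y.
have D0 y : 0 < D y.
  rewrite /D; have [->|p1'] := eqVneq p 1; first by rewrite subrr add0r mul1r expR_gt0.
  have := mulr_ge0 p0 (expR_ge0 y); have : p < 1 by rewrite lt_neqAle p1'.
  lra.
pose h : R -> R := fun y => y ^+ 2 / 8 + y * p - ln (D y).
pose k : R -> R := fun y => y / 4 - p * expR y * (D y)^-1.
have dD (y : R) : is_derive y 1 D (p * expR y).
  by rewrite /D; apply: is_derive_eq; rewrite /GRing.scale /=; ring.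
have dh (y : R) : is_derive y 1 h (p + k y).
  have ? := is_derive1_ln (D0 y).
  rewrite /h /k; apply: is_derive_eq.
  rewrite /GRing.scale /=. field; rewrite gt_eqF//.
have dk (y : R) : is_derive y 1 k (4^-1 - p * expR y / D y * (1 - p * expR y / D y)).
  have Dn0 : D y != 0 by rewrite gt_eqF.
  rewrite /k; apply: is_derive_eq.
  rewrite /GRing.scale /=; field; rewrite gt_eqF//.
have [c cx hc] : exists2 c, c \in `]0, x[ & h x - h 0 = (p + k c) * (x - 0).
  apply: MVT => //; apply: derivable_within_continuous => z _.
  by have [] := dh z.
move: cx; rewrite in_itv/= => /andP[c0 _].
have [d _ kd] : exists2 d, d \in `]0, c[ & k c - k 0 = (4^-1 - p * expR d / D d * (1 - p * expR d / D d)) * (c - 0).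
  apply: MVT => //; apply: derivable_within_continuous => z _.
  by have [] := dk z.
have D_0 : D 0 = 1 by rewrite /D expR0 mulr1 subrK.
have k0 : k 0 = - p by rewrite /k mul0r D_0 expR0 invr1 !mulr1 sub0r.
have h0 : h 0 = 0 by rewrite /h D_0 ln1 expr0n !mul0r addr0 subr0.
have pk : 0 <= p + k c.
  rewrite -[p]opprK -k0 addrC kd subr0 mulr_ge0//; last exact: ltW.
  set q := (_ / _); have := sqr_ge0 (q - 2^-1); rewrite expr2; lra.
have : 0 <= h x.
  have -> : h x = h x - h 0 by rewrite h0 subr0.
  by rewrite hc subr0 mulr_ge0// ltW.
rewrite /h subr_ge0 -ler_expR lnK ?posrE// -(ler_pM2l (expR_gt0 (- (x * p)))) -expRD.
rewrite (_ : - (x * p) + _ = x ^+ 2 / 8); last by ring.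
apply: le_trans; rewrite /D.
have -> : expR (x * (1 - p)) = expR (- (x * p)) * expR x by rewrite -expRD; congr expR; ring.
by rewrite le_eqVlt; apply/orP; left; apply/eqP; ring.
Qed.

(** Negative [x] reduces to positive [x] by exchanging [p] and [1 - p]. *)
Lemma hoeffding_bernoulli (R : realType) (p x : R) : 0 <= p <= 1 ->
  p * expR (x * (1 - p)) + (1 - p) * expR (- (x * p)) <= expR (x ^+ 2 / 8).
Proof.
move=> p01; have [x0|x0|->] := ltgtP x 0.
- have p01' : 0 <= 1 - p <= 1 by move/andP: p01 => [? ?]; apply/andP; split; lra.
  have x0' : 0 < - x by rewrite oppr_gt0.
  have := hoeffding_bernoulli_pos p01' x0'.
  by rewrite sqrrN subKr !mulNr opprK addrC.
- exact: hoeffding_bernoulli_pos.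
- by rewrite !mul0r oppr0 expr0n !mul0r expR0 !mulr1 addrC subrK.
Qed.

(** Sign and magnitude are kept apart so that, once the magnitude is bounded, lattice points range
    over a finite type. *)
Lemma round_half (R : realType) (y : R) :
  exists b k, `|(-1) ^+ (b : bool) * k%:R - y| <= 2^-1.
Proof.
exists (y < 0), (Num.truncn (`|y| + 2^-1)).
have : 0 <= `|y| + 2^-1 by rewrite addr_ge0// invr_ge0.
move=> /Num.Theory.truncn_itv; set k := Num.truncn _ => /andP[k1 k2].
have -> : (-1) ^+ (y < 0)%R * k%:R - y = (-1) ^+ (y < 0)%R * (k%:R - `|y|).
  by rewrite mulrBr -numEsign.
rewrite normrM normrX normrN1 expr1n mul1r ler_norml; apply/andP; split.
  by move: k2; rewrite -[k.+1%:R]natr1; lra.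
by move: k1; lra.
Qed.

(** For the top singular triple [(a, u, v)], symmetry gives [A v = a u] and [A u = a v]. So [u + v]
    and [u - v] satisfy the eigenvector equation for [a] and [- a], and they cannot both vanish
    because [u] is a unit vector. *)
Lemma svd_eigenvector (R : realType) n (A : 'M[R]_n) s U V (b : R) :
  (0 < n)%N -> is_svd A s U V -> A^T = A -> ~ op_bound A b ->
  exists (a : R) (e : bool) (x : 'cV_n),
    [/\ b < a, op_bound A a, x != 0 & A *m x = ((-1) ^+ e * a) *: x].
Proof.
case: n A s U V => // n A s U V _ [s0 UU VV AE] At hb.
have {}AE : A = U *m diag_mx (\row_i s i) *m V^T.
  rewrite AE (svd_sumE s U V predT) (_ : diag_mx _ = 1%:M) ?mul1mx//.
  by apply/matrixP => i j; rewrite !mxE.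
pose i0 := [arg max_(i > ord0) s i]%O.
have s_max i : s i <= s i0.
  by rewrite /i0; case: arg_maxP => // j _; apply.
have opA : op_bound A (s i0).
  rewrite AE; apply: op_bound_orthogonal; rewrite ?trmxK ?orthogonal_trmx//.
  by apply: op_bound_diag => // i; rewrite mxE ger0_norm.
have Av : A *m col i0 V = s i0 *: col i0 U.
  rewrite AE !colE !mulmxA -(mulmxA _ V^T) VV mulmx1 -!mulmxA scalemxAr.
  by congr (U *m _); apply/matrixP => i j; rewrite mul_diag_mx !mxE; case: eqP => [->|]//; rewrite ?mulr0.
have Au : A *m col i0 U = s i0 *: col i0 V.
  rewrite -At AE !trmx_mul tr_diag_mx trmxK.
  rewrite !colE !mulmxA -(mulmxA _ U^T) UU mulmx1 -!mulmxA scalemxAr.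
  by congr (V *m _); apply/matrixP => i j; rewrite mul_diag_mx !mxE; case: eqP => [->|]//; rewrite ?mulr0.
have ba : b < s i0.
  by rewrite ltNge; apply/negP => sb; apply: hb; apply: op_bound_le opA.
have [uv0|uv] := eqVneq (col i0 U + col i0 V) 0; last first.
  exists (s i0), false, (col i0 U + col i0 V); split=> //.
  by rewrite mulmxDr Av Au expr0 mul1r scalerDr addrC.
exists (s i0), true, (col i0 U - col i0 V); split=> //; last first.
  by rewrite mulmxBr Av Au expr1 mulN1r scaleNr scalerBr opprB.
apply/eqP => uv1.
have : fdot (col i0 U) (col i0 U) = 1.
  by rewrite !colE fdot_isom// fdot_vec (bigD1 i0)//= big1 ?mxE ?eqxx ?mulr1 ?addr0// => j ji; rewrite mxE (negPf ji) mul0r.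
have -> : col i0 U = 0.
  have := congr2 +%R uv0 uv1; rewrite addr0 addrACA subrr addr0 -mulr2n => /eqP.
  by rewrite -scaler_nat scaler_eq0 pnatr_eq0 /= => /eqP.
have /eqP -> : fdot (0 : 'cV[R]_n.+1) 0 == 0 by rewrite fdot_eq0.
by move/esym/eqP; rewrite oner_eq0.
Qed.

Definition lattice_vec (R : nzRingType) n N (g : {ffun 'I_n -> bool * 'I_N}) : 'cV[R]_n :=
  \col_i ((-1) ^+ (g i).1 * (g i).2%:R).

(* Rounding the eigenvector of norm [2 sqrt n] moves it by at most [sqrt n / 2]. *)
Lemma lattice_witness (R : realType) n (A : 'M[R]_n) s U V (b : R) :
  (0 < n)%N -> 0 <= b -> is_svd A s U V -> A^T = A -> ~ op_bound A b ->
  exists (e : bool) (g : {ffun 'I_n -> bool * 'I_(7 * n)}),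
    let z := lattice_vec R g in
    [/\ 9 / 4 * n%:R <= fdot z z, fdot z z <= 25 / 4 * n%:R &
        b * (fdot z z - n%:R / 2) <= (-1) ^+ e * fdot z (A *m z)].
Proof.
move=> n0 b0 hA At hb.
have [a [e [x [ba opA x0 Ax]]]] := svd_eigenvector n0 hA At hb.
have n0' : 0 < n%:R :> R by rewrite ltr0n.
have x2 : 0 < fdot x x by rewrite lt_neqAle fdot_ge0 eq_sym fdot_eq0 x0.
pose y := Num.sqrt (4 * n%:R / fdot x x) *: x.
have yy : fdot y y = 4 * n%:R.
  rewrite /y fdotZl fdotZr mulrA -expr2 sqr_sqrtr; last by rewrite divr_ge0 ?mulr_ge0 ?ler0n// ltW.
  by rewrite divfK// gt_eqF.
have Ay : A *m y = ((-1) ^+ e * a) *: y.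
  by rewrite /y -scalemxAr Ax !scalerA mulrC.
clearbody y.
have [bk hbk] : exists bk : 'I_n -> bool * nat,
    forall i, `|(-1) ^+ (bk i).1 * (bk i).2%:R - y i 0| <= 2^-1.
  have /(_ _)/cid2 := fun i => let: ex_intro b (ex_intro k h) := round_half (y i 0) in
    ex_intro2 (fun _ => True) (fun bk : bool * nat => `|(-1) ^+ bk.1 * bk.2%:R - y i 0| <= 2^-1) (b, k) I h.
  by move=> H; exists (fun i => s2val (H i)) => i; have := s2valP' (H i).
pose z : 'cV[R]_n := \col_i ((-1) ^+ (bk i).1 * (bk i).2%:R).
pose d := z - y.
have dd : fdot d d <= n%:R / 4.
  rewrite fdot_vec; apply: (@le_trans _ _ (\sum_(i < n) 4^-1)).
    apply: ler_sum => i _; rewrite !mxE; have := hbk i.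
    set w := _ - y i 0; rewrite ler_norml => /andP[w1 w2].
    have : 0 <= (2^-1 - w) * (2^-1 + w) by rewrite mulr_ge0//; lra.
    lra.
  by rewrite sumr_const card_ord -[leLHS]mulr_natl.
have zE : z = y + d by rewrite /d addrC subrK.
clearbody d.
have q0 : 0 < 4^-1 :> R by rewrite invr_gt0.
(* Young with weight 1/4, as [|y|^2 = 4 n]. With [|d|^2 <= n/4] the two bounds on [fdot y d] give
   [9/4 n] and [25/4 n] as limits for [|z|^2]. *)
have yd : - (n%:R / 2 + 2 * fdot d d) <= fdot y d.
  have := fdot_young (- y) d q0; rewrite fdotNl fdotNl fdotNr yy.
  have := fdot_ge0 d; lra.
have yd' : fdot y d <= n%:R / 2 + 2 * fdot d d.
  have := fdot_young y d q0; rewrite yy.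
  have := fdot_ge0 d; lra.
have zz : fdot z z = 4 * n%:R + 2 * fdot y d + fdot d d.
  by rewrite zE fdotDl !fdotDr yy (fdotC d y); ring.
have z1 : 9 / 4 * n%:R <= fdot z z by rewrite zz; lra.
have z2 : fdot z z <= 25 / 4 * n%:R by rewrite zz; lra.
(* A coordinate of size at least [7 n] would have a square of at least [7 n], more than [|z|^2];
   this crude cutoff makes the net finite. *)
have bk_lt i : ((bk i).2 < 7 * n)%N.
  have : (bk i).2%:R ^+ 2 <= fdot z z.
    rewrite fdot_vec (bigD1 i)//= mxE -expr2 exprMn -exprM mulnC exprM sqrrN expr1n expr1n mul1r lerDl.
    by apply: sumr_ge0 => j _; rewrite -expr2 sqr_ge0.
  move=> /le_trans/(_ z2) h; rewrite ltnNge; apply/negP => k7.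
  have : (7 * n)%:R <= (bk i).2%:R ^+ 2 :> R.
    by rewrite -natrX ler_nat (leq_trans k7)// -{1}[(bk i).2]expn1 leq_pexp2l// (leq_trans _ k7)// muln_gt0.
  rewrite natrM => /le_trans/(_ h); lra.
exists e, [ffun i => ((bk i).1, Ordinal (bk_lt i))].
have -> : lattice_vec R [ffun i => ((bk i).1, Ordinal (bk_lt i))] = z.
  by apply/matrixP => i j; rewrite !mxE !ffunE.
split=> //.
have s2 : (-1) ^+ e * (-1) ^+ e = 1 :> R by rewrite -expr2 -exprM mulnC exprM sqrrN expr1n expr1n.
have dAd : - (a * fdot d d) <= (-1) ^+ e * fdot d (A *m d).
  have h1 := opA d d; have h2 := op_boundN opA d d.
  rewrite mulNmx fdotNr in h2; case: (e); rewrite ?expr1 ?expr0; lra.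
(* As [y] is an eigenvector, the quadratic form at [z] is known up to the term in [d]. It is at
   least [a (|z|^2 - 2 |d|^2)], and [2 |d|^2 <= n/2]. *)
have zAz : (-1) ^+ e * fdot z (A *m z) =
    a * (fdot y y + 2 * fdot y d) + (-1) ^+ e * fdot d (A *m d).
  have yAd : fdot y (A *m d) = (-1) ^+ e * a * fdot y d.
    by rewrite -[A]At -fdot_mull Ay fdotZl.
  rewrite zE mulmxDr fdotDl !fdotDr Ay !fdotZr yAd (fdotC d y) !mulrDr !mulrA s2; ring.
apply: (@le_trans _ _ (a * (fdot z z - n%:R / 2))).
  by rewrite ler_wpM2r ?ltW//; lra.
have a0 : 0 <= a by apply: le_trans b0 (ltW ba).
rewrite zAz yy -subr_ge0.
have h : 0 <= a * (n%:R / 2 - 2 * fdot d d) by rewrite mulr_ge0//; lra.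
have : a * (fdot z z - n%:R / 2) = a * (4 * n%:R + 2 * fdot y d) - a * fdot d d - a * (n%:R / 2 - 2 * fdot d d).
  by rewrite zz; ring.
move=> ->; lra.
Qed.

Lemma sum_geometric_le (R : realFieldType) (x : R) N : 0 <= x < 1 ->
  \sum_(i < N) x ^+ i <= (1 - x)^-1.
Proof.
move=> /andP[x0 x1]; have x1' : 0 < 1 - x by rewrite subr_gt0.
rewrite -(ler_pM2l x1') mulfV ?gt_eqF//.
by rewrite -(opprB x) mulNr -subrX1 opprB gerBl exprn_ge0.
Qed.

(** Since [(k + 1)^2 >= 3 k + 1], the tail is dominated by a geometric series of ratio
    [q^3 <= (64/81)^3 < 1/2], so the sum is at most [1 + 2 * 64/81]. *)
Lemma sum_theta_le (R : realFieldType) (q : R) N : 0 <= q <= 64 / 81 ->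
  \sum_(k < N) q ^+ (k ^ 2) <= 209 / 81.
Proof.
move=> /andP[q0 q1]; case: N => [|N]; first by rewrite big_ord0; lra.
rewrite big_ord_recl /= expr0.
have qq : q ^+ 3 <= (64 / 81) ^+ 3 by rewrite lerXn2r ?nnegrE//; lra.
have q3 : 0 <= q ^+ 3 < 1 by rewrite exprn_ge0//=; move: qq; lra.
apply: (@le_trans _ _ (1 + q * \sum_(k < N) (q ^+ 3) ^+ k)).
  rewrite lerD2l mulr_sumr; apply: ler_sum => k _.
  rewrite -exprM -exprS ler_wiXn2l//; first by move: q1; lra.
  rewrite /bump /= add1n; nia.
apply: (@le_trans _ _ (1 + 64 / 81 * 2)); last by lra.
rewrite lerD2l; apply: ler_pM => //.
  by apply: sumr_ge0 => i _; rewrite !exprn_ge0.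
apply: le_trans (sum_geometric_le _ q3) _.
rewrite -[leRHS]invrK lef_pV2 ?posrE ?invr_gt0//; lra.
Qed.

(** Square the tangent bound [exp(1/8) >= 9/8] and invert. *)
Lemma expR_quarter_le (R : realType) : expR (- (1 / 4)) <= 64 / 81 :> R.
Proof.
have -> : - (1 / 4) = - (8^-1 + 8^-1) :> R by field.
rewrite expRN expRD.
have h : 9 / 8 <= expR 8^-1 :> R by apply: le_trans (expR_ge1Dx _); lra.
have -> : 64 / 81 = (9 / 8 * (9 / 8))^-1 :> R by field.
rewrite lef_pV2 ?posrE ?mulr_gt0 ?expR_gt0//; try lra.
by apply: ler_pM => //; lra.
Qed.

Lemma lattice_vec_norm (R : realType) n N (g : {ffun 'I_n -> bool * 'I_N}) :
  fdot (lattice_vec R g) (lattice_vec R g) = \sum_i (g i).2%:R ^+ 2.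
Proof.
rewrite fdot_vec; apply: eq_bigr => i _.
by rewrite mxE -expr2 exprMn -exprM mulnC exprM sqrrN expr1n expr1n mul1r.
Qed.

(* [199/200] bounds [2 q^7 sum_k q^(k^2)] for [q = exp(-1/4) <= 64/81]. The
   factor 2 is the sign, which counts the coordinate 0 twice. *)
Lemma net_sum (R : realType) n N :
  \sum_(g : {ffun 'I_n -> bool * 'I_N})
    expR (- (fdot (lattice_vec R g) (lattice_vec R g) / 4 + 7 / 4 * n%:R))
  <= (199 / 200 : R) ^+ n.
Proof.
pose q : R := expR (- (1 / 4)).
have q0 : 0 <= q by rewrite expR_ge0.
have q1 : q <= 64 / 81 := expR_quarter_le R.
under eq_bigr => g _.
  have -> : expR (- (fdot (lattice_vec R g) (lattice_vec R g) / 4 + 7 / 4 * n%:R)) =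
      \prod_(i < n) (q ^+ ((g i).2 ^ 2) * q ^+ 7).
    rewrite lattice_vec_norm big_split /= prodr_const card_ord -exprM /q -expRM_natr.
    rewrite [X in _ = X * _](eq_bigr (fun i => expR (- ((g i).2%:R ^+ 2 / 4)))) => [|i _]; last first.
      by rewrite -expRM_natr natrX; congr expR; ring.
    rewrite -expR_sum -expRD natrM sumrN -mulr_suml; congr expR; ring.
  over.
rewrite -(bigA_distr_bigA (fun (i : 'I_n) (x : bool * 'I_N) => q ^+ (x.2 ^ 2) * q ^+ 7)) /=.
rewrite prodr_const card_ord lerXn2r ?nnegrE//; first by apply: sumr_ge0 => i _; rewrite mulr_ge0 ?exprn_ge0.
rewrite -(pair_big predT predT (fun (_ : bool) (k : 'I_N) => q ^+ (k ^ 2) * q ^+ 7)) /=.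
rewrite big_bool /= -mulr_suml.
have h1 := sum_theta_le N (_ : 0 <= q <= 64 / 81).
have {}h1 : \sum_(k < N) q ^+ (k ^ 2) <= 209 / 81 by apply: h1; rewrite q0 q1.
have h2 : q ^+ 7 <= (64 / 81) ^+ 7 by rewrite lerXn2r ?nnegrE//; lra.
have h3 : (\sum_(k < N) q ^+ (k ^ 2)) * q ^+ 7 <= 209 / 81 * (64 / 81) ^+ 7.
  by apply: ler_pM; rewrite ?exprn_ge0// sumr_ge0// => i _; rewrite exprn_ge0.
by lra.
Qed.

(** Cleared of denominators the claim is a cubic inequality in [S]. The difference is a quarter of
    [(S - 9/4 n) (25/4 n - S) (S - n/2)] plus a linear term, both nonnegative on the given range. *)
Lemma net_exponent (R : realType) (n S : R) : 0 < n ->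
  9 / 4 * n <= S -> S <= 25 / 4 * n ->
  S / 4 + 7 / 4 * n <= (2 * Num.sqrt n * (S - n / 2)) ^+ 2 / S ^+ 2.
Proof.
move=> n0 S1 S2; have S0 : 0 < S by lra.
rewrite ler_pdivlMr; last by rewrite exprn_gt0.
rewrite !exprMn sqr_sqrtr; last exact: ltW.
have h1 : 0 <= (S - 9 / 4 * n) * (25 / 4 * n - S) * (S - n / 2).
  by rewrite !mulr_ge0//; lra.
have h2 : 0 <= n ^+ 2 * (37 / 16 * S - 97 / 32 * n).
  by rewrite mulr_ge0// ?sqr_ge0//; lra.
rewrite -subr_ge0; have h3 : 0 <= 4^-1 * ((S - 9 / 4 * n) * (25 / 4 * n - S) * (S - n / 2) + n ^+ 2 * (37 / 16 * S - 97 / 32 * n)).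
  by rewrite mulr_ge0 ?invr_ge0// addr_ge0.
apply: le_trans h3 _; rewrite le_eqVlt; apply/orP; left; apply/eqP; by field.
Qed.

(** * Tail of the noise for a fixed mean matrix *)

Section Noise.
Variables (R : realType) (n : nat).

Definition pattern := {ffun 'I_n * 'I_n -> bool}.

(* Patterns carry information only above the diagonal. *)
Definition upper_patterns : pred pattern :=
  pfamily false (fun e : 'I_n * 'I_n => e.1 < e.2)%N (fun=> predT).

Definition edge_mass (a : pattern) (M : 'M[R]_n) : R :=
  \prod_(i < n) \prod_(j < n | (i < j)%N) (if a (i, j) then M i j else 1 - M i j).

(** With a zero diagonal, the quadratic form is a sum over edges of terms that are independent and
    centred under [edge_mass]. *)
Definition noise_mx (a : pattern) (M : 'M[R]_n) : 'M[R]_n :=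
  \matrix_(i, j) (if (i < j)%N then (a (i, j))%:R - M i j
                  else if (j < i)%N then (a (j, i))%:R - M j i else 0).

(** The conclusion of [lattice_witness] for [b = 2 sqrt n], as a decidable condition on each sign
    and lattice vector. *)
Definition exceeds (a : pattern) (M : 'M[R]_n) (e : bool)
    (g : {ffun 'I_n -> bool * 'I_(7 * n)}) : bool :=
  let z := lattice_vec R g in
  [&& 9 / 4 * n%:R <= fdot z z, fdot z z <= 25 / 4 * n%:R &
      2 * Num.sqrt n%:R * (fdot z z - n%:R / 2) <=
        (-1) ^+ e * fdot z (noise_mx a M *m z)].

Lemma noise_mx_sym a M : (noise_mx a M)^T = noise_mx a M.
Proof. by apply/matrixP => i j; rewrite !mxE; case: ltngtP. Qed.

Lemma sum_sym_offdiag (F : 'I_n -> 'I_n -> R) : (forall i j, F i j = F j i) ->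
  \sum_i \sum_j F i j = 2 * (\sum_(e : 'I_n * 'I_n | (e.1 < e.2)%N) F e.1 e.2) + \sum_i F i i.
Proof.
move=> Fsym; rewrite -(pair_big_dep predT (fun i j : 'I_n => (i < j)%N) (fun i j => F i j)) /=.
have -> : \sum_i \sum_j F i j =
    \sum_(i < n) \sum_(j < n | (i < j)%N) F i j + \sum_(i < n) \sum_(j < n | (j < i)%N) F i j + \sum_i F i i.
  rewrite -!big_split /=; apply: eq_bigr => i _.
  rewrite (bigD1 i)//= addrC; congr (_ + _).
  rewrite (bigID (fun j : 'I_n => (i < j)%N)) /=; congr (_ + _); apply: eq_bigl => j.
    by rewrite -val_eqE /=; case: ltngtP.
  by rewrite -val_eqE /=; case: ltngtP.
rewrite mulr_natl mulr2n; congr (_ + _ + _).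
rewrite (exchange_big_dep predT) //=; apply: eq_bigr => i _; apply: eq_bigr => j _; exact: Fsym.
Qed.

Lemma noise_quadratic a M (z : 'cV_n) :
  fdot z (noise_mx a M *m z) =
  2 * \sum_(e : 'I_n * 'I_n | (e.1 < e.2)%N) z e.1 0 * z e.2 0 * ((a e)%:R - M e.1 e.2).
Proof.
have -> : fdot z (noise_mx a M *m z) = \sum_i \sum_j z i 0 * z j 0 * noise_mx a M i j.
  rewrite fdot_vec; apply: eq_bigr => i _; rewrite mxE mulr_sumr; apply: eq_bigr => j _; ring.
rewrite sum_sym_offdiag => [|i j]; last first.
  by rewrite -[noise_mx a M in LHS]noise_mx_sym mxE [z i 0 * _]mulrC.
rewrite [X in _ + X]big1 ?addr0 => [|i _]; last by rewrite mxE ltnn mulr0.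
by congr (_ * _); apply: eq_bigr => -[i j] /= ij; rewrite mxE ij.
Qed.

Lemma edge_massE a M : edge_mass a M =
  \prod_(e : 'I_n * 'I_n | (e.1 < e.2)%N) (if a e then M e.1 e.2 else 1 - M e.1 e.2).
Proof.
rewrite /edge_mass (pair_big_dep predT (fun i j : 'I_n => (i < j)%N)
  (fun i j => if a (i, j) then M i j else 1 - M i j)) /=.
by apply: eq_bigr => -[].
Qed.

Lemma edge_mass_ge0 a (M : 'M[R]_n) : (forall i j, 0 <= M i j <= 1) -> 0 <= edge_mass a M.
Proof.
move=> M01; apply: prodr_ge0 => i _; apply: prodr_ge0 => j _.
by have /andP[? ?] := M01 i j; case: ifP => _ //; rewrite subr_ge0.
Qed.

(** The moment generating function factors over edges. Hoeffding at [y e = 2 l z_i z_j] bounds each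
    factor, and [2 sum_(i<j) z_i^2 z_j^2 <= |z|^4]. *)
Lemma noise_mgf (M : 'M[R]_n) (z : 'cV_n) (l : R) : (forall i j, 0 <= M i j <= 1) ->
  \sum_(a in upper_patterns) edge_mass a M * expR (l * fdot z (noise_mx a M *m z)) <=
  expR (l ^+ 2 * fdot z z ^+ 2 / 4).
Proof.
move=> M01.
pose y (e : 'I_n * 'I_n) := 2 * l * (z e.1 0 * z e.2 0).
pose F (e : 'I_n * 'I_n) (b : bool) :=
  (if b then M e.1 e.2 else 1 - M e.1 e.2) * expR (y e * (b%:R - M e.1 e.2)).
rewrite (eq_bigr (fun a : pattern => \prod_(e : 'I_n * 'I_n | (e.1 < e.2)%N) F e (a e))) => [|a _]; last first.
  rewrite edge_massE noise_quadratic big_split /= -expR_sum; congr (_ * expR _).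
  by rewrite mulrCA mulrA mulr_sumr; apply: eq_bigr => e _; rewrite /y; ring.
(* Upper patterns are the independent choices of one boolean per edge, so the sum of products is a
   product of sums. *)
rewrite -(big_distr_big_dep false) /=.
apply: (@le_trans _ _ (\prod_(e : 'I_n * 'I_n | (e.1 < e.2)%N) expR (y e ^+ 2 / 8))).
  apply: ler_prod => e _; rewrite big_bool /F /=; apply/andP; split.
    have /andP[? ?] := M01 e.1 e.2.
    by rewrite addr_ge0// mulr_ge0 ?expR_ge0// subr_ge0.
  by rewrite sub0r mulrN hoeffding_bernoulli.
rewrite -expR_sum ler_expR.
have : 2 * (\sum_(e : 'I_n * 'I_n | (e.1 < e.2)%N) (z e.1 0 ^+ 2 * z e.2 0 ^+ 2)) <= fdot z z ^+ 2.
  rewrite expr2 {1}fdot_vec mulr_suml.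
  under [leRHS]eq_bigr => i _ do rewrite -expr2 fdot_vec mulr_sumr.
  under [leRHS]eq_bigr => i _ do under eq_bigr => j _ do rewrite -expr2.
  rewrite sum_sym_offdiag => [|i j]; last by rewrite mulrC.
  by rewrite lerDl sumr_ge0// => i _; rewrite mulr_ge0 ?sqr_ge0.
have -> : \sum_(e : 'I_n * 'I_n | (e.1 < e.2)%N) y e ^+ 2 / 8 =
    l ^+ 2 / 4 * (2 * \sum_(e : 'I_n * 'I_n | (e.1 < e.2)%N) (z e.1 0 ^+ 2 * z e.2 0 ^+ 2)).
  rewrite mulrA mulr_sumr; apply: eq_bigr => e _; rewrite /y; by field.
by move=> h; rewrite [leRHS]mulrAC; apply: ler_wpM2l => //; rewrite divr_ge0 ?sqr_ge0.
Qed.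

Lemma fdot_noise_sign a M (e : bool) (z : 'cV_n) l :
  l * ((-1) ^+ e * fdot z (noise_mx a M *m z)) = ((-1) ^+ e * l) * fdot z (noise_mx a M *m z).
Proof. ring. Qed.

(* Chernoff with the optimal [l = 2 t / |z|^4]. *)
Lemma noise_tail_vec (M : 'M[R]_n) e g : (0 < n)%N -> (forall i j, 0 <= M i j <= 1) ->
  \sum_(a in upper_patterns) edge_mass a M * (exceeds a M e g)%:R <=
  expR (- (fdot (lattice_vec R g) (lattice_vec R g) / 4 + 7 / 4 * n%:R)).
Proof.
move=> n0 M01; set z := lattice_vec R g; set S := fdot z z.
have n0' : 0 < n%:R :> R by rewrite ltr0n.
have [/andP[S1 S2]|hS] := boolP ((9 / 4 * n%:R <= S) && (S <= 25 / 4 * n%:R)); last first.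
  rewrite big1 ?expR_ge0// => a _; rewrite /exceeds -/z -/S andbA.
  by rewrite (negPf hS) mulr0.
have S0 : 0 < S by lra.
pose t : R := 2 * Num.sqrt n%:R * (S - n%:R / 2).
have t0 : 0 <= t by rewrite !mulr_ge0 ?sqrtr_ge0//; lra.
pose l : R := 2 * t / S ^+ 2.
have l0 : 0 <= l by apply: divr_ge0; [apply: mulr_ge0 | exact: sqr_ge0].
(* Markov: the indicator of [Q >= t] is at most [exp(l (Q - t))], with [Q] the signed quadratic
   form. *)
apply: (@le_trans _ _ (\sum_(a in upper_patterns) edge_mass a M *
    (expR (((-1) ^+ e * l) * fdot z (noise_mx a M *m z)) * expR (- (l * t))))).
  apply: ler_sum => a _; rewrite ler_wpM2l ?edge_mass_ge0// -expRD -fdot_noise_sign -mulrBr.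
  rewrite /exceeds -/z -/S -/t; case: and3P => [[_ _ h]|_] /=; last exact: expR_ge0.
  by apply: le_trans (expR_ge1Dx _); rewrite lerDl mulr_ge0// subr_ge0.
under eq_bigr => a _ do rewrite mulrA.
rewrite -mulr_suml; apply: (le_trans (ler_wpM2r (expR_ge0 _) (noise_mgf _ _ M01))).
rewrite -expRD ler_expR exprMn -exprM mulnC exprM sqrrN expr1n expr1n mul1r -/S.
have -> : l ^+ 2 * S ^+ 2 / 4 - l * t = - (t ^+ 2 / S ^+ 2).
  by rewrite /l; field; rewrite gt_eqF.
by rewrite lerN2; apply: net_exponent.
Qed.

(** Union bound; the factor 2 counts the two signs [e]. *)
Lemma noise_tail (M : 'M[R]_n) : (0 < n)%N -> (forall i j, 0 <= M i j <= 1) ->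
  \sum_(a in upper_patterns) \sum_e \sum_g edge_mass a M * (exceeds a M e g)%:R <=
  2 * (199 / 200) ^+ n.
Proof.
move=> n0 M01; rewrite exchange_big /= mulr_natl mulr2n.
suff h e : \sum_(a in upper_patterns) \sum_g edge_mass a M * (exceeds a M e g)%:R <= (199 / 200) ^+ n.
  by rewrite big_bool lerD.
rewrite exchange_big /=; apply: le_trans (net_sum R n (7 * n)).
by apply: ler_sum => g _; apply: noise_tail_vec.
Qed.

Lemma noise_exceeds (a : pattern) (M : 'M[R]_n) s U V : (0 < n)%N ->
  is_svd (noise_mx a M) s U V -> ~ op_bound (noise_mx a M) (2 * Num.sqrt n%:R) ->
  exists e g, exceeds a M e g.
Proof.
move=> n0 hsvd hb.
have [|e [g /= [h1 h2 h3]]] := lattice_witness n0 _ hsvd (noise_mx_sym a M) hb.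
  by rewrite mulr_ge0 ?sqrtr_ge0.
by exists e, g; rewrite /exceeds h1 h2.
Qed.

End Noise.

(** * Approximation of graphons by combinations of rectangles *)

Section RectangleSpan.
Context d1 d2 (T1 : measurableType d1) (T2 : measurableType d2) (R : realType).

(* The index [K] bounds the sum of the absolute values of the coefficients. *)
Inductive rect_span : R -> (T1 * T2 -> R) -> Prop :=
| rect_span_indic A B of measurable A & measurable B :
    rect_span 1 (fun x => \1_A x.1 * \1_B x.2)
| rect_spanD K1 K2 h1 h2 of rect_span K1 h1 & rect_span K2 h2 :
    rect_span (K1 + K2) (fun x => h1 x + h2 x)
| rect_spanZ K c h of rect_span K h : rect_span (`|c| * K) (fun x => c * h x).

Lemma rect_span_le K h x : rect_span K h -> `|h x| <= K.
Proof.
elim=> [A B _ _|K1 K2 h1 h2 _ IH1 _ IH2|K' c h' _ IH].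
- by rewrite !indicE; case: (_ \in _); case: (_ \in _); rewrite ?mulr1 ?mulr0 ?mul0r ?normr1 ?normr0.
- by apply: le_trans (ler_normD _ _) _; rewrite lerD.
- by rewrite normrM ler_wpM2l.
Qed.

Lemma rect_span_ge0 K h : rect_span K h -> 0 <= K.
Proof. by elim=> // [K1 K2 h1 h2 _ ? _ ?|K' c h' _ ?]; rewrite ?addr_ge0 ?mulr_ge0. Qed.

Lemma rect_span_measurable K h : rect_span K h -> measurable_fun setT h.
Proof.
elim=> [A B mA mB|K1 K2 h1 h2 _ IH1 _ IH2|K' c h' _ IH].
- by apply: measurable_funM; apply: measurableT_comp.
- exact: measurable_funD.
- exact: measurable_funM.
Qed.

(** A rectangle yields a rank-one matrix [u v^T] with 0-1 vectors of squared norm at most [n], so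
    its nuclear norm is at most [n]. Sums and multiples follow by the triangle inequality. *)
Lemma rect_span_nuclear n K h (x : 'I_n -> T1) (y : 'I_n -> T2) : rect_span K h ->
  nuclear_bound (\matrix_(i, j) h (x i, y j)) (K * n%:R).
Proof.
elim=> [A B _ _|K1 K2 h1 h2 _ IH1 _ IH2|K' c h' _ IH] Y b hY.
- pose u : 'cV[R]_n := \col_i \1_A (x i); pose v : 'cV[R]_n := \col_i \1_B (y i).
  have -> : fdot Y (\matrix_(i, j) (\1_A (x i) * \1_B (y j))) = fdot u (Y *m v).
    rewrite fdot_vec; apply: eq_bigr => i _; rewrite !mxE mulr_sumr.
    by apply: eq_bigr => j _; rewrite !mxE; ring.
  have unit_le (w : 'cV[R]_n) : (forall i, 0 <= w i 0 <= 1) -> fdot w w <= n%:R.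
    move=> w01; rewrite fdot_vec -[n in leRHS]card_ord -sum1_card natr_sum.
    by apply: ler_sum => i _; have /andP[? ?] := w01 i; rewrite -[leRHS]mul1r ler_pM.
  have u1 : fdot u u <= n%:R.
    by apply: unit_le => i; rewrite mxE indicE; case: (_ \in _); rewrite ?ler01 ?lexx.
  have v1 : fdot v v <= n%:R.
    by apply: unit_le => i; rewrite mxE indicE; case: (_ \in _); rewrite ?ler01 ?lexx.
  apply: le_trans (hY u v) _.
  (* The empty matrix is treated apart, since there [b] may be negative. *)
  case: n x y Y hY u v u1 v1 {unit_le} => [|n] x y Y hY u v u1 v1.
    by rewrite !fdot_vec !big_ord0 addr0 mulr0 !mul0r mulr0 mul0r.
  have b0 : 0 <= b := op_bound_ge0 hY.
  have : b * (fdot u u + fdot v v) <= b * (n.+1%:R + n.+1%:R) by rewrite ler_wpM2l// lerD.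
  rewrite mul1r; lra.
- have -> : \matrix_(i, j) (h1 (x i, y j) + h2 (x i, y j)) =
      \matrix_(i, j) h1 (x i, y j) + \matrix_(i, j) h2 (x i, y j).
    by apply/matrixP => i j; rewrite !mxE.
  by rewrite fdotDr !mulrDl lerD// ?IH1 ?IH2.
- have -> : \matrix_(i, j) (c * h' (x i, y j)) = c *: \matrix_(i, j) h' (x i, y j).
    by apply/matrixP => i j; rewrite !mxE.
  rewrite fdotZr; apply: le_trans (ler_norm _) _; rewrite normrM.
  have h1 := IH Y b hY; have h2 := IH (- Y) b (op_boundN hY); rewrite fdotNl in h2.
  by rewrite -!mulrA ler_wpM2l// ler_norml mulrA h1 lerNl h2.
Qed.

End RectangleSpan.

Section RectangleApproximation.
Context d1 d2 (T1 : measurableType d1) (T2 : measurableType d2) (R : realType).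
Variable mu : probability (T1 * T2)%type R.
Implicit Types (h g : T1 * T2 -> R).

Definition rect_approx h := forall e : R, 0 < e -> exists K g,
  rect_span K g /\ (\int[mu]_x ((h x - g x) ^+ 2)%:E <= e%:E)%E.

Lemma integral_sqrD_le (a b : T1 * T2 -> R) : measurable_fun setT a -> measurable_fun setT b ->
  (\int[mu]_x ((a x + b x) ^+ 2)%:E <=
   2%:E * \int[mu]_x (a x ^+ 2)%:E + 2%:E * \int[mu]_x (b x ^+ 2)%:E)%E.
Proof.
move=> ma mb.
have m2 (f : T1 * T2 -> R) : measurable_fun setT f -> measurable_fun setT (fun x => (f x ^+ 2)%:E : \bar R).
  by move=> mf; apply/measurable_EFinP; exact: measurable_funX.
have sq0 (f : T1 * T2 -> R) (x : T1 * T2) : setT x -> (0 <= (f x ^+ 2)%:E :> \bar R)%E by rewrite lee_fin sqr_ge0.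
have n0 : (0 <= (2 : R)%:E)%E by rewrite lee_fin.
rewrite -(ge0_integralZl mu measurableT (m2 _ ma) (sq0 _) n0)// -(ge0_integralZl mu measurableT (m2 _ mb) (sq0 _) n0)//.
rewrite -ge0_integralD//=.
- apply: ge0_le_integral => //=.
  + by move=> x xT; exact: (sq0 (fun x => a x + b x)).
  + by apply: m2; exact: measurable_funD.
  + by apply: emeasurable_funD; apply: measurable_funeM; exact: m2.
  + move=> x _; rewrite -!EFinM -EFinD lee_fin.
    have := sqr_ge0 (a x - b x); rewrite !expr2; lra.
- by move=> x _; rewrite mule_ge0// sq0.
- by apply: measurable_funeM; exact: m2.
- by move=> x _; rewrite mule_ge0// sq0.
- by apply: measurable_funeM; exact: m2.
Qed.

(** Closure under [L^2] limits. The budget [e / 4] appears twice, each time doubled by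
    [(a + b)^2 <= 2 a^2 + 2 b^2]. *)
Lemma rect_approx_lim h : measurable_fun setT h ->
  (forall e : R, 0 < e -> exists h', [/\ measurable_fun setT h', rect_approx h' &
     (\int[mu]_x ((h x - h' x) ^+ 2)%:E <= e%:E)%E]) -> rect_approx h.
Proof.
move=> mh hlim e e0; have e4 : 0 < e / 4 by rewrite divr_gt0.
have [h' [mh' ah' hh']] := hlim _ e4; have [K [g [Kg h'g]]] := ah' _ e4.
exists K, g; split => //.
rewrite (eq_integral (fun x => ((h x - h' x + (h' x - g x)) ^+ 2)%:E)); last first.
  by move=> x _; rewrite addrA subrK.
have mg := rect_span_measurable Kg.
apply: le_trans (integral_sqrD_le _ _) _; try exact: measurable_funB.
apply: (@le_trans _ _ (2%:E * (e / 4)%:E + 2%:E * (e / 4)%:E)%E).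
  by apply: leeD; apply: lee_wpmul2l => //; rewrite lee_fin.
by rewrite -!EFinM -EFinD lee_fin; lra.
Qed.

Lemma rect_approxD h1 h2 : measurable_fun setT h1 -> measurable_fun setT h2 ->
  rect_approx h1 -> rect_approx h2 -> rect_approx (fun x => h1 x + h2 x).
Proof.
move=> mh1 mh2 a1 a2 e e0; have e4 : 0 < e / 4 by rewrite divr_gt0.
have [K1 [g1 [Kg1 i1]]] := a1 _ e4; have [K2 [g2 [Kg2 i2]]] := a2 _ e4.
exists (K1 + K2), (fun x => g1 x + g2 x); split; first exact: rect_spanD.
rewrite (eq_integral (fun x => ((h1 x - g1 x + (h2 x - g2 x)) ^+ 2)%:E)); last first.
  by move=> x _; congr (_ ^+ 2)%:E; ring.
have mg1 := rect_span_measurable Kg1; have mg2 := rect_span_measurable Kg2.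
apply: le_trans (integral_sqrD_le _ _) _; try exact: measurable_funB.
apply: (@le_trans _ _ (2%:E * (e / 4)%:E + 2%:E * (e / 4)%:E)%E).
  by apply: leeD; apply: lee_wpmul2l => //; rewrite lee_fin.
by rewrite -!EFinM -EFinD lee_fin; lra.
Qed.

Lemma rect_approx_span K g : rect_span K g -> rect_approx g.
Proof.
move=> Kg e e0; exists K, g; split => //.
under eq_integral do rewrite subrr expr0n /=.
by rewrite integral0 lee_fin ltW.
Qed.

Lemma rect_approxZ c h : measurable_fun setT h ->
  rect_approx h -> rect_approx (fun x => c * h x).
Proof.
move=> mh ah e e0; have c0 : 0 < c ^+ 2 + 1 by rewrite ltr_wpDl// sqr_ge0.
(* The summand 1 in the denominator avoids a separate case [c = 0]. *)
have [K [g [Kg i]]] := ah (e / (c ^+ 2 + 1)) (divr_gt0 e0 c0).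
exists (`|c| * K), (fun x => c * g x); split; first exact: rect_spanZ.
have mg := rect_span_measurable Kg.
rewrite (eq_integral (fun x => ((c ^+ 2)%:E * ((h x - g x) ^+ 2)%:E)%E)); last first.
  by move=> x _; rewrite -EFinM -exprMn mulrBr.
have mhg : measurable_fun setT (fun x => ((h x - g x) ^+ 2)%:E : \bar R).
  by apply/measurable_EFinP; apply: measurable_funX; exact: measurable_funB.
have hg0 x : setT x -> (0 <= ((h x - g x) ^+ 2)%:E :> \bar R)%E by rewrite lee_fin sqr_ge0.
have c20 : (0 <= (c ^+ 2)%:E :> \bar R)%E by rewrite lee_fin sqr_ge0.
rewrite (ge0_integralZl mu measurableT mhg hg0 c20)//.
apply: (@le_trans _ _ ((c ^+ 2)%:E * (e / (c ^+ 2 + 1))%:E)%E).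
  by apply: lee_wpmul2l => //; rewrite lee_fin sqr_ge0.
rewrite -EFinM lee_fin mulrCA ger_pMr// ler_pdivrMr// mul1r lerDl//.
Qed.

Lemma integral_sqr_indic (A : set (T1 * T2)) : measurable A ->
  (\int[mu]_x ((\1_A x : R) ^+ 2)%:E = mu A)%E.
Proof.
move=> mA; rewrite -[in RHS](setIT A) -integral_indic//.
by apply: eq_integral => x _; rewrite indicE; case: (_ \in _); rewrite ?expr1n ?expr0n.
Qed.

(** Dynkin induction from the rectangles, a generating family closed under intersection. For a
    disjoint union, finite partial unions are handled by additivity and the limit by continuity of
    [mu]. *)
Lemma rect_approx_indic (E : set (T1 * T2)) : measurable E -> rect_approx \1_E.
Proof.
pose G := [set A `*` B | A in @measurable _ T1 & B in @measurable _ T2].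
have GE : @measurable _ (T1 * T2)%type = <<s G >> by exact: measurable_prod_measurableType.
have rectE A B : (\1_(A `*` B) : T1 * T2 -> R) = fun x => \1_A x.1 * \1_B x.2.
  by apply/funext => x; rewrite !indicE in_setX; case: (_ \in _); case: (_ \in _); rewrite /= ?mulr1 ?mulr0.
have mi (A : set (T1 * T2)) : measurable A -> measurable_fun setT (\1_A : _ -> R) by move=> mA; exact: measurable_indic.
have rT : rect_approx \1_setT.
  by rewrite -setXTT rectE; apply: rect_approx_span; exact: rect_span_indic.
have rC S : measurable S -> rect_approx \1_S -> rect_approx \1_(~` S).
  move=> mS aS; have -> : (\1_(~` S) : T1 * T2 -> R) = fun x => \1_setT x + (-1) * \1_S x.
    by apply/funext => x; rewrite !indicE in_setC in_setT; case: (_ \in _); rewrite /= ?mulr1 ?mulr0 ?subrr ?addr0.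
  apply: rect_approxD rT (rect_approxZ _ (mi _ mS) aS); first exact: mi measurableT.
  by apply: measurable_funM => //; exact: mi.
rewrite GE; move: E.
apply: (@dynkin_induction _ _ G (fun S => rect_approx \1_S) GE _ rT _ rC).
- move=> _ _ [A1 mA1 [B1 mB1 <-]] [A2 mA2 [B2 mB2 <-]].
  exists (A1 `&` A2); first exact: measurableI.
  by exists (B1 `&` B2); [exact: measurableI | rewrite setXI].
- move=> _ [A mA [B mB <-]]; rewrite rectE.
  by apply: rect_approx_span; exact: rect_span_indic.
move=> F mF tF aF; have mU : measurable (\bigcup_k F k) by exact: bigcup_measurable.
pose H n := \big[setU/set0]_(k < n) F k.
have mH n : measurable (H n) by exact: bigsetU_measurable.
have aH n : rect_approx \1_(H n).
  elim: n => [|n IH].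
    by rewrite /H big_ord0 -setCT; apply: rC => //; exact: measurableT.
  have -> : (\1_(H n.+1) : T1 * T2 -> R) = fun x => \1_(H n) x + \1_(F n) x.
    apply/funext => x; rewrite /H big_ord_recr /= -/(H n) !indicE in_setU.
    have [xF|_] := boolP (x \in F n); last by rewrite orbF addr0.
    rewrite orbT (_ : (x \in H n) = false) ?add0r//; apply/negbTE/negP => xH.
    move: xH xF; rewrite !inE /H -bigcup_mkord => -[k /= kn Fk] Fn.
    have /trivIsetP/(_ k n I I) := tF; rewrite (ltn_eqF kn) => /(_ isT); rewrite -subset0; apply; split; [exact: Fk | exact: Fn].
  by apply: rect_approxD => //; exact: mi.
apply: rect_approx_lim => [|e e0]; first exact: mi.
(* The tails of the union decrease to the empty set, and the squared [L^2] distance between the two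
   indicators is the measure of the tail. *)
have : mu (\bigcup_k F k `\` H n) @[n --> \oo] --> (0 : \bar R)%E.
  have -> : 0%E = mu (\bigcap_n (\bigcup_k F k `\` H n)).
    rewrite (_ : \bigcap_n _ = set0) ?measure0//.
    rewrite -subset0 => x /= hx.
    have [[k _ Fkx] _] := hx 0%N I.
    have [_] := hx k.+1 I; apply; rewrite /H -bigcup_mkord; exists k => //=.
  apply: nonincreasing_cvg_mu.
  - by rewrite (le_lt_trans (probability_le1 _ _)) ?ltry//; apply: measurableD.
  - by move=> n; apply: measurableD.
  - by apply: bigcapT_measurable => n; exact: measurableD mU (mH _).
  - move=> m n mn; apply/subsetPset => x [Ux nHx]; split => // Hx; apply: nHx.
    move: Hx; rewrite /H -!bigcup_mkord => -[k /= km Fk]; exists k => //=.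
    exact: leq_trans km mn.
move=> /fine_cvgP [_ /cvgrPdist_le /(_ e e0) [N _ hN]].
exists \1_(H N); split; [exact: mi (mH N) | exact: aH | ].
rewrite (eq_integral (fun x => ((\1_(\bigcup_k F k `\` H N) x) ^+ 2)%:E)).
  have mD : measurable (\bigcup_k F k `\` H N) by exact: measurableD.
  rewrite integral_sqr_indic//.
  have := hN N (leqnn N); rewrite sub0r normrN ger0_norm ?fine_ge0// => h.
  by rewrite -[leLHS]fineK ?fin_num_measure//.
move=> x _; rewrite !indicE in_setD.
have : x \in H N -> x \in \bigcup_k F k.
  rewrite !inE /H -bigcup_mkord => -[k _ Fkx]; exists k => //.
by case: (x \in H N) => /= [/(_ isT) ->|_]; rewrite ?subrr ?subr0 ?expr0n /= ?andbF ?andbT ?mulr0n ?expr0n.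
Qed.

(** The sum counts the positive integers up to [y], that is, its integer part. *)
Lemma sum_level_sets (y : R) m : 0 <= y -> y <= m%:R ->
  \sum_(k < m) (k.+1%:R <= y)%R%:R <= y <= 1 + \sum_(k < m) (k.+1%:R <= y)%R%:R.
Proof.
elim: m y => [|m IH] y y0 ym; first by rewrite big_ord0 addr0 y0/=; lra.
rewrite big_ord_recl /= (_ : (1%:R <= y) = (1 <= y))//; have [y1|y1] := leP 1 y.
  have {IH} := IH (y - 1); rewrite subr_ge0 y1 => /(_ isT).
  rewrite lerBlDr natr1 ym => /(_ isT).
  have -> : \sum_(k < m) (k.+1%:R <= y - 1)%R%:R = \sum_(k < m) ((bump 0 k).+1%:R <= y)%R%:R :> R.
    by apply: eq_bigr => k _; rewrite lerBrDr natr1.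
  by move=> /andP[? ?]; rewrite (_ : (true%:R : R) = 1)//; apply/andP; split; lra.
rewrite big1 ?add0r ?addr0 ?y0 ?ltW// => k _.
rewrite leNgt (lt_le_trans y1)//= ?ler1n//.
Qed.

(** The average of the indicators of the level sets [m h >= k + 1] approximates [h] from below
    within [1/m]; the squared error is then at most [1/m <= e]. *)
Lemma rect_approx_bounded h : measurable_fun setT h -> (forall x, 0 <= h x <= 1) ->
  rect_approx h.
Proof.
move=> mh h01; apply: rect_approx_lim => // e e0.
pose m := (Num.truncn (e^-1)).+1.
have m0 : 0 < m%:R :> R by rewrite ltr0n.
have em : m%:R^-1 <= e.
  by rewrite -[leRHS]invrK lef_pV2 ?posrE ?invr_gt0// ltW// truncnS_gt.
have m1 : 1 <= m%:R :> R by rewrite ler1n.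
pose E k := [set x | k.+1%:R <= m%:R * h x].
have mE k : measurable (E k).
  rewrite -[E k]setTI; apply: measurable_fun_le => //.
  exact: measurable_funM.
pose h' n x : R := \sum_(k < n) m%:R^-1 * \1_(E k) x.
have mh' n : measurable_fun setT (h' n).
  by apply: measurable_sum => k; apply: measurable_funM => //; exact: measurable_indic.
have ah' n : rect_approx (h' n).
  elim: n => [|n IH].
    have -> : h' 0%N = fun x => 0 * \1_setT x.
      by apply/funext => x; rewrite /h' big_ord0 mul0r.
    by apply: rect_approxZ; [exact: measurable_indic | exact: rect_approx_indic].
  have -> : h' n.+1 = fun x => h' n x + m%:R^-1 * \1_(E n) x.
    by apply/funext => x; rewrite /h' big_ord_recr.
  apply: rect_approxD => //; first by apply: measurable_funM => //; exact: measurable_indic.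
  by apply: rect_approxZ; [exact: measurable_indic | exact: rect_approx_indic].
exists (h' m); split=> //.
apply: (@le_trans _ _ (\int[mu]_x e%:E)%E).
  apply: ge0_le_integral => //=.
  - by move=> x _; rewrite lee_fin sqr_ge0.
  - by apply/measurable_EFinP; apply: measurable_funX; exact: measurable_funB.
  move=> x _; rewrite lee_fin; have /andP[h0 h1] := h01 x.
  have := @sum_level_sets (m%:R * h x) m; rewrite (mulr_ge0 (ltW m0) h0) => /(_ isT).
  rewrite ger_pMr// h1 => /(_ isT).
  rewrite (_ : \sum_(k < m) _ = m%:R * h' m x); last first.
    rewrite /h' mulr_sumr; apply: eq_bigr => k _; rewrite mulrA mulfV ?gt_eqF// mul1r indicE.
    by congr (_%:R); rewrite mem_setE.
  move=> /andP[l1 l2].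
  have a1 : 0 <= h x - h' m x by rewrite subr_ge0 -(ler_pM2l m0).
  have a2 : h x - h' m x <= m%:R^-1.
    by rewrite -(ler_pM2l m0) mulfV ?gt_eqF// mulrBr lerBlDr.
  apply: le_trans em; rewrite expr2 -[leRHS]mulr1; apply: ler_pM => //.
  by apply: le_trans a2 _; rewrite invf_le1.
rewrite integral_cst//. by rewrite [X in (_ * X)%E](@probability_setT _ _ _ mu) mule1.
Qed.

End RectangleApproximation.

(** * Pairs of sampled points *)

Section UniformLaw.
Variable R : realType.
Let idTR : measurableTypeR R -> R := idfun.
Let measurable_idTR : measurable_fun setT idTR.
Proof. exact: (@measurable_id _ (measurableTypeR R) setT). Qed.

#[local] HB.instance Definition _ :=
  @isMeasurableFun.Build _ _ (measurableTypeR R) R idTR measurable_idTR.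

(* [uniform_prob] lives on [measurableTypeR R], whose display differs from the
   one of [R]. *)
Definition unif_law : probability R R := distribution (uniform_prob (@ltr01 R)) idTR.

End UniformLaw.

Section PairLaw.
Context (R : realType) d (T : measurableType d) (P : probability T R) (n : nat)
  (U : 'I_n -> {RV P >-> R}).
Hypothesis hU : iid_uniform U.
Local Notation unif := (unif_law R).
Local Notation unif2 := (unif_law R \x unif_law R)%E.

Lemma measurable_pair i j : measurable_fun setT (fun w => (U i w, U j w)).
Proof. by apply: measurable_fun_pair. Qed.

Lemma pair_independent i j (A B : set R) : i != j -> measurable A -> measurable B ->
  P ((fun w => (U i w, U j w)) @^-1` (A `*` B)) = (unif A * unif B)%E.
Proof.
move=> ij mA mB; have [_ Ulaw Uind] := hU.
pose S k := if k == i then A else if k == j then B else setT.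
have mS k : measurable (S k) by rewrite /S; case: ifP => // _; case: ifP.
have -> : (fun w => (U i w, U j w)) @^-1` (A `*` B) = \bigcap_k (U k @^-1` S k).
  apply/seteqP; split=> [w [/= Aw Bw] k _|w hw].
    by rewrite /preimage /= /S; case: eqP => [->//|_]; case: eqP => [->//|].
  split=> /=; first by have := hw i I; rewrite /preimage /= /S eqxx.
  by have := hw j I; rewrite /preimage /= /S eqxx eq_sym (negPf ij).
rewrite Uind// (bigD1 i)//= (bigD1 j) 1?eq_sym//= big1 ?mule1 => [|k /andP[ki kj]].
  rewrite /S !eqxx [j == i]eq_sym (negPf ij).
  by congr (_ * _)%E; exact: Ulaw.
by rewrite /S (negPf ki) (negPf kj) preimage_setT probability_setT.
Qed.

(** The law of the pair and the product law agree on rectangles, hence everywhere by uniqueness of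
    the product measure. *)
Lemma ge0_integral_pair i j (h : R * R -> \bar R) : i != j ->
  measurable_fun setT h -> (forall x, 0 <= h x)%E ->
  (\int[P]_w h (U i w, U j w) = \int[unif2]_x h x)%E.
Proof.
move=> ij mh h0; have mp := measurable_pair i j.
pose phi : {mfun T >-> (R * R)%type} := HB.pack (fun w => (U i w, U j w)) (isMeasurableFun.Build _ _ _ _ _ mp).
rewrite -[LHS](@ge0_integral_distribution _ _ _ _ _ P phi)//.
apply: eq_measure_integral => A mA _; apply/esym.
apply: product_measure_unique mA => B1 B2 mB1 mB2; exact: pair_independent.
Qed.

(** Off-diagonal pairs follow the product law and contribute at most [e] each. The [n] diagonal
    pairs do not, and are bounded by [c], for a total of [c / n] after averaging. *)
Lemma expected_average (h : R * R -> R) (c e : R) : (0 < n)%N ->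
  measurable_fun setT h -> (forall x, 0 <= h x <= c) ->
  (\int[unif2]_x (h x)%:E <= e%:E)%E ->
  (\int[P]_w ((n%:R ^+ 2)^-1 * \sum_i \sum_j h (U i w, U j w))%:E <= (e + c / n%:R)%:E)%E.
Proof.
move=> n0 mh h0c he; have n0' : 0 < n%:R :> R by rewrite ltr0n.
have h0 x : 0 <= h x by have /andP[] := h0c x.
have mhp i j : measurable_fun setT (fun w => (h (U i w, U j w))%:E).
  by apply/measurable_EFinP; apply: (measurableT_comp mh (measurable_pair i j)).
have e0 : 0 <= e.
  by rewrite -lee_fin; apply: le_trans he; apply: integral_ge0 => x _; rewrite lee_fin.
have c0 : 0 <= c by have /andP[? ?] := h0c point; apply: le_trans (h0 point) _.
under eq_integral => w _.
  rewrite EFinM -sumEFin; under eq_bigr do rewrite -sumEFin.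
  over.
rewrite ge0_integralZl//=; last 2 first.
- by apply: emeasurable_sum => i; apply: emeasurable_sum => j; exact: mhp.
- by move=> w _; do 2![apply: sume_ge0 => ? _]; rewrite lee_fin.
rewrite ge0_integral_sum//=; last 2 first.
- by move=> i; apply: emeasurable_sum => j; exact: mhp.
- by move=> i w _; apply: sume_ge0 => j _; rewrite lee_fin.
have hij i j : (\int[P]_w (h (U i w, U j w))%:E <= (e + (i == j)%:R * c)%:E)%E.
  have [->|ij] := eqVneq i j.
    apply: (@le_trans _ _ (\int[P]_w c%:E)%E).
      apply: ge0_le_integral => //= [w _|w _].
        by rewrite lee_fin.
      by rewrite lee_fin; have /andP[] := h0c (U j w, U j w).
    rewrite integral_cst// [X in (_ * X)%E](@probability_setT _ _ _ P) mule1 lee_fin mul1r; lra.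
  rewrite (@ge0_integral_pair i j (fun x => (h x)%:E) ij); last 2 first.
  - exact/measurable_EFinP.
  - by move=> x; rewrite lee_fin.
  by rewrite mul0r addr0.
apply: (@le_trans _ _ ((n%:R ^+ 2)^-1%:E * \sum_(i < n) (n%:R * e + c)%:E)%E).
  apply: lee_wpmul2l; first by rewrite lee_fin invr_ge0 sqr_ge0.
  apply: lee_sum => i _; rewrite ge0_integral_sum//=; last by move=> j w _; rewrite lee_fin.
  apply: (@le_trans _ _ (\sum_(j < n) (e + (i == j)%:R * c)%:E)%E); first exact: lee_sum.
  rewrite sumEFin lee_fin big_split /= sumr_const card_ord -[e *+ n]mulr_natl lerD2l.
  rewrite (bigD1 i)//= eqxx mul1r big1 ?addr0// => j ji.
  by rewrite eq_sym (negPf ji) mul0r.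
rewrite sumEFin -EFinM lee_fin sumr_const card_ord -mulr_natl le_eqVlt; apply/orP; left.
by apply/eqP; field; rewrite gt_eqF.
Qed.

End PairLaw.

(** * Probability of the noise events *)

Section NoiseProbability.
Context (R : realType) (f : R * R -> R) (hf : graphon f).
Context d (T : measurableType d) (P : probability T R) (n : nat)
  (U : 'I_n -> {RV P >-> R}) (X : T -> 'M[R]_n).
Hypothesis hU : iid_uniform U.
Hypothesis hX : graphon_random_graph f U X.
Hypothesis n_gt0 : (0 < n)%N.

(** Extension by 0, measurable on the whole plane and equal to [f] at the sampled points. *)
Definition graphon_ext : R * R -> R := f \_ (`[0, 1] `*` `[0, 1]).

Lemma measurable_graphon_ext : measurable_fun setT graphon_ext.
Proof.
have [mf _ _] := hf.
by apply: (measurable_restrictT f (measurableX (measurable_itv _) (measurable_itv _))).1 mf.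
Qed.

Lemma graphon_extE (x y : R) : x \in `[0, 1] -> y \in `[0, 1] -> graphon_ext (x, y) = f (x, y).
Proof. by move=> hx hy; rewrite /graphon_ext /patch ifT// inE /=; split. Qed.

Lemma graphon_ext_itv x : 0 <= graphon_ext x <= 1.
Proof.
case: x => x y; rewrite /graphon_ext /patch; case: ifPn => [|_]; last by rewrite lexx ler01.
by have [_ f01 _] := hf; rewrite inE => -[/= hx hy]; exact: f01.
Qed.

Local Notation M w := (mean_matrix f (fun i => U i : T -> R) w).

Lemma mean_matrixE w i j : M w i j = graphon_ext (U i w, U j w).
Proof. by have [U01 _ _] := hU; rewrite mxE graphon_extE. Qed.

Lemma mean_matrix_itv w i j : 0 <= M w i j <= 1.
Proof. by rewrite mean_matrixE graphon_ext_itv. Qed.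

Lemma mean_matrix_sym w : (M w)^T = M w.
Proof.
have [U01 _ _] := hU; have [_ _ fC] := hf.
by apply/matrixP => i j; rewrite !mxE fC.
Qed.

Lemma measurable_fun_quadratic d' (T' : measurableType d') (N : T' -> 'M[R]_n) a (z : 'cV_n) :
  (forall i j, measurable_fun setT (fun w => N w i j)) ->
  measurable_fun setT (fun w => fdot z (noise_mx a (N w) *m z)).
Proof.
move=> mN; under eq_fun do rewrite noise_quadratic.
apply: measurable_funM => //; under eq_fun do rewrite big_mkcond.
apply: measurable_sum => e; case: (e.1 < e.2)%N => //.
apply: measurable_funM => //; apply: measurable_funB => //; exact: mN.
Qed.

(** The source space is arbitrary because this is applied to [T] with its own sigma-algebra and with
    the one generated by the [U i]. *)
Lemma measurable_exceeds d' (T' : measurableType d') (N : T' -> 'M[R]_n) a e g :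
  (forall i j, measurable_fun setT (fun w => N w i j)) ->
  measurable [set w | exceeds a (N w) e g].
Proof.
move=> mN; rewrite /exceeds; set z := lattice_vec R g.
case: (9 / 4 * n%:R <= fdot z z); last by rewrite (_ : [set _ | _] = set0)//; apply/seteqP; split.
case: (fdot z z <= 25 / 4 * n%:R); last by rewrite (_ : [set _ | _] = set0)//; apply/seteqP; split.
rewrite /= -[X in measurable X]setTI; apply: measurable_fun_le => //.
by apply: measurable_funM => //; exact: measurable_fun_quadratic.
Qed.

Lemma measurable_edge_mass d' (T' : measurableType d') (N : T' -> 'M[R]_n) (a : pattern n) :
  (forall i j, measurable_fun setT (fun w => N w i j)) ->
  measurable_fun setT (fun w => edge_mass a (N w)).
Proof.
move=> mN; apply: measurable_prod => i _; under eq_fun do rewrite big_mkcond.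
apply: measurable_prod => j _; case: (i < j)%N => //; case: (a (i, j)); first exact: mN.
by apply: measurable_funB => //; exact: mN.
Qed.

Lemma measurable_mean_matrix i j : measurable_fun setT (fun w => M w i j).
Proof.
under eq_fun do rewrite mean_matrixE.
exact: measurableT_comp measurable_graphon_ext (measurable_pair U i j).
Qed.

Let G := \big[setU/set0]_(i < n) preimage_set_system setT (U i : T -> R) measurable.

(** The conditional law of the edges can only be integrated over events generated by the [U i]; [M]
    depends on nothing else. *)
Lemma g_sigma_preimage_exceeds a e g :
  g_sigma_preimage (fun i => U i : T -> R) [set w | exceeds a (M w) e g].
Proof.
pose S := g_sigma_algebraType G.
have mU i : measurable_fun setT (U i : S -> R).
  move=> _ A mA; apply: sub_sigma_algebra; rewrite /G (bigD1 i)//=.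
  by left; exists A.
have mM i j : measurable_fun setT ((fun w => M w i j) : S -> R).
  under eq_fun do rewrite mean_matrixE.
  apply: (measurableT_comp measurable_graphon_ext).
  exact: measurable_fun_pair.
exact: (@measurable_exceeds _ S (fun w => M w)).
Qed.

Definition noise_event (a : pattern n) e g : set T :=
  [set w | exceeds a (M w) e g] `&`
  [set w | forall i j : 'I_n, (i < j)%N -> X w i j = (a (i, j))%:R].

Lemma noise_event_measurable a e g : measurable (noise_event a e g).
Proof.
apply: measurableI; first exact: measurable_exceeds measurable_mean_matrix.
have [_ mX _] := hX.
rewrite (_ : [set _ | _] = \bigcap_(i : 'I_n) \bigcap_(j : 'I_n)
   (if (i < j)%N then (fun w => X w i j) @^-1` [set (a (i, j))%:R] else setT)); last first.
  apply/seteqP; split=> w.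
    by move=> h i _ j _; case: ifP => // ij; exact: h.
  by move=> h i j ij; have := h i I j I; rewrite ij.
apply: fin_bigcap_measurable => // i _; apply: fin_bigcap_measurable => // j _.
case: ifP => // _; rewrite -[X in measurable X]setTI; exact: mX.
Qed.

Lemma noise_event_prob a e g :
  P (noise_event a e g) =
  (\int[P]_w (edge_mass a (M w) * (exceeds a (M w) e g)%:R)%:E)%E.
Proof.
have [_ _ cond] := hX; rewrite /noise_event.
rewrite (cond (fun i j => a (i, j)) _ (g_sigma_preimage_exceeds a e g)).
rewrite integral_mkcond; apply: eq_integral => w _; rewrite /patch.
have -> : edge_mass a (M w) = \prod_(i < n) \prod_(j < n | (i < j)%N)
    (if a (i, j) then f (U i w, U j w) else 1 - f (U i w, U j w)).
  by apply: eq_bigr => i _; apply: eq_bigr => j _; rewrite !mxE.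
case: ifPn => [/set_mem/= ->|/negP hw]; first by rewrite mulr1.
have -> : exceeds a (M w) e g = false by apply/negP => h; apply: hw; exact: mem_set.
by rewrite mulr0.
Qed.

(** By the conditional law each probability is an integral over the sampled points, so [noise_tail]
    applies pointwise under the integral. *)
Lemma noise_event_sum :
  (\sum_(a in @upper_patterns n) \sum_e \sum_g P (noise_event a e g) <=
   (2 * (199 / 200) ^+ n)%:E)%E.
Proof.
pose F a e g w : R := edge_mass a (M w) * (exceeds a (M w) e g)%:R.
have F0 a e g w : (0 <= (F a e g w)%:E)%E.
  by rewrite lee_fin mulr_ge0// edge_mass_ge0// => i j; exact: mean_matrix_itv.
have mF a e g : measurable_fun setT (fun w => (F a e g w)%:E).
  apply/measurable_EFinP; apply: measurable_funM.
    exact: measurable_edge_mass measurable_mean_matrix.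
  have -> : (fun w => (exceeds a (M w) e g)%:R) = \1_[set w | exceeds a (M w) e g] :> (T -> R).
    by apply/funext => w; rewrite indicE mem_setE.
  by apply: measurable_indic; exact: measurable_exceeds measurable_mean_matrix.
have -> : (\sum_(a in @upper_patterns n) \sum_e \sum_g P (noise_event a e g) =
    \int[P]_w (\sum_(a in @upper_patterns n) \sum_e \sum_g (F a e g w)%:E))%E.
  under [in RHS]eq_integral do rewrite -big_filter.
  rewrite ge0_integral_sum//; last 2 first.
  - by move=> a; do 2![apply: emeasurable_sum => ?]; exact: mF.
  - by move=> a w _; do 2![apply: sume_ge0 => ? _].
  rewrite big_filter; apply: eq_bigr => a _.
  rewrite ge0_integral_sum//; last 2 first.
  - by move=> e; apply: emeasurable_sum => g; exact: mF.
  - by move=> e w _; apply: sume_ge0 => ? _.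
  apply: eq_bigr => e _; rewrite ge0_integral_sum//.
  by apply: eq_bigr => g _; exact: noise_event_prob.
apply: (@le_trans _ _ (\int[P]_w (2 * (199 / 200) ^+ n)%:E)%E).
  apply: ge0_le_integral => //=.
  - by move=> w _; do 3![apply: sume_ge0 => ? _].
  - under eq_fun do rewrite -big_filter.
    by do 3![apply: emeasurable_sum => ?]; exact: mF.
  move=> w _; under eq_bigr => a _.
    under eq_bigr do rewrite sumEFin.
    rewrite sumEFin; over.
  rewrite sumEFin lee_fin; apply: noise_tail => // i j; exact: mean_matrix_itv.
by rewrite integral_cst// [X in (_ * X)%E](@probability_setT _ _ _ P) mule1.
Qed.

End NoiseProbability.

(** * The risk bound *)

Lemma truncate_sqr_le (R : realType) (x m : R) : `|m| <= 1 ->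
  (truncate x - m) ^+ 2 <= (x - m) ^+ 2.
Proof.
rewrite ler_norml => /andP[m1 m2].
(* The hypothesis says that [y] lies between [m] and [x]; truncation moves [x] towards [[-1, 1]],
   which contains [m]. *)
have key (y : R) : 0 <= (x - y) * (y - m) -> (y - m) ^+ 2 <= (x - m) ^+ 2.
  have := sqr_ge0 (x - y); rewrite !expr2; lra.
rewrite /truncate; case: ltP => [x1|_]; first by apply: key; rewrite mulr_ge0//; lra.
case: ltP => // x1; apply: key; rewrite -mulrNN mulr_ge0//; lra.
Qed.

Lemma truncate_error_le4 (R : realType) (x m : R) : `|m| <= 1 -> (truncate x - m) ^+ 2 <= 4.
Proof.
rewrite ler_norml => /andP[m1 m2].
have : -1 <= truncate x <= 1.
  rewrite /truncate; case: (ltP 1 x) => h1; first by apply/andP; split; lra.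
  by case: (ltP x (-1)) => h2; apply/andP; split; lra.
move=> /andP[t1 t2]; have : 0 <= (2 - (truncate x - m)) * (2 + (truncate x - m)).
  by rewrite mulr_ge0//; lra.
rewrite expr2; lra.
Qed.

Lemma fdot_sqr (R : realFieldType) m n (A : 'M[R]_(m, n)) : fdot A A = \sum_i \sum_j A i j ^+ 2.
Proof. by apply: eq_bigr => i _; apply: eq_bigr => j _; rewrite expr2. Qed.

(** * Loss of the estimator for a given graph *)

Section Deterministic.
Variables (R : realType) (n : nat) (eta : R).
Hypotheses (n_gt0 : (0 < n)%N) (heta : 0 < eta < 1).
Variables (A Mhat M : 'M[R]_n).
Hypotheses (hM : forall i j, 0 <= M i j <= 1) (hA : is_usvt eta A Mhat).

Let mse : R := (n%:R ^+ 2)^-1 * \sum_(i < n) \sum_(j < n) (Mhat i j - M i j) ^+ 2.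

Let normM i j : `|M i j| <= 1.
Proof. by have /andP[? ?] := hM i j; rewrite ger0_norm. Qed.

Lemma usvt_error_le4 : mse <= 4.
Proof.
have [s [U [V [_ MhatE]]]] := hA.
rewrite /mse MhatE mulrC ler_pdivrMr ?exprn_gt0 ?ltr0n//.
apply: (@le_trans _ _ (\sum_(i < n) \sum_(j < n) 4)).
  apply: ler_sum => i _; apply: ler_sum => j _; rewrite mxE; exact: truncate_error_le4.
by rewrite !sumr_const !card_ord -(mulr_natr (4 *+ n)) -(mulr_natr 4) -mulrA.
Qed.

(** The assumption on [n] gives [eta sqrt n >= 2], so the gap [t - b = eta sqrt n - 1] is at least
    [eta sqrt n / 2]. With [b] and [t] at most [3 sqrt n], the thresholding inequality yields the
    constants 36 and 12. *)
Lemma usvt_error_le (B : 'M[R]_n) (K : R) : 0 <= K -> 4 <= n%:R * eta ^+ 2 ->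
  op_bound (A - M) (2 * Num.sqrt n%:R + 1) -> nuclear_bound B (K * n%:R) ->
  mse <= (36 / eta ^+ 2 + 1) * ((n%:R ^+ 2)^-1 * fdot (M - B) (M - B))
         + (36 / eta + 12) * K / Num.sqrt n%:R.
Proof.
move=> K0 n_large hAM hB; have /andP[eta0 eta1] := heta.
have [s [U [V [[s0 UU VV AE] MhatE]]]] := hA.
pose r : R := Num.sqrt n%:R; have r0 : 0 < r by rewrite sqrtr_gt0 ltr0n.
have rr : n%:R = r ^+ 2 by rewrite sqr_sqrtr.
have er : 2 <= eta * r.
  have er_ge0 : 0 <= eta * r by rewrite mulr_ge0 ?ltW.
  rewrite -(@ler_pXn2r _ 2) ?nnegrE//= exprMn -rr mulrC.
  by apply: (le_trans _ n_large); rewrite expr2; lra.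
have r2 : 1 <= r.
  have : eta * r <= 1 * r by rewrite ler_pM2r// ltW.
  lra.
pose t := (2 + eta) * r; pose b := 2 * r + 1; pose d := fdot (M - B) (M - B).
have d0 : 0 <= d by exact: fdot_ge0.
have b0 : 0 < b by rewrite /b; lra.
have tb : eta * r / 2 <= t - b by rewrite /t /b; lra.
have er0 : 0 < eta * r / 2 by rewrite divr_gt0// mulr_gt0.
have tb0 : 0 < t - b by apply: lt_le_trans tb.
have bt : b < t by rewrite -subr_gt0.
have b3 : b <= 3 * r by rewrite /b; lra.
have t3 : t <= 3 * r by rewrite /t ler_pM2r//; lra.
rewrite AE in hAM.
have := usvt_frobenius s0 UU VV b0 bt hAM hB; rewrite -/d; set W := \sum_(i | _) _ => hW.
have hle : \sum_(i < n) \sum_(j < n) (Mhat i j - M i j) ^+ 2 <= fdot (W - M) (W - M).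
  rewrite fdot_sqr; apply: ler_sum => i _; apply: ler_sum => j _.
  by rewrite MhatE !mxE; exact: truncate_sqr_le.
have k0 : 0 <= K * n%:R by rewrite mulr_ge0.
have h1 : b ^+ 2 * (d / (t - b) ^+ 2) <= 36 / eta ^+ 2 * d.
  apply: (@le_trans _ _ ((3 * r) ^+ 2 * (d / (eta * r / 2) ^+ 2))); last first.
    by rewrite le_eqVlt; apply/orP; left; apply/eqP; field; rewrite !gt_eqF.
  apply: ler_pM; rewrite ?sqr_ge0 ?divr_ge0 ?sqr_ge0//.
    by apply: lerXn2r => //; rewrite nnegrE; lra.
  rewrite ler_wpM2l// lef_pV2 ?posrE ?exprn_gt0//.
  by apply: lerXn2r => //; rewrite nnegrE ltW.
have h2 : b ^+ 2 * (2 * (K * n%:R) / (t - b)) <= 36 / eta * (K * r ^+ 3).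
  apply: (@le_trans _ _ ((3 * r) ^+ 2 * (2 * (K * n%:R) / (eta * r / 2)))); last first.
    by rewrite rr le_eqVlt; apply/orP; left; apply/eqP; field; rewrite !gt_eqF.
  apply: ler_pM; rewrite ?sqr_ge0//.
  - by rewrite divr_ge0 ?mulr_ge0// ltW.
  - by apply: lerXn2r => //; rewrite nnegrE; lra.
  by rewrite ler_wpM2l ?mulr_ge0// lef_pV2 ?posrE.
have h3 : 2 * (K * n%:R) * (t + b) <= 12 * (K * r ^+ 3).
  apply: (@le_trans _ _ (2 * (K * n%:R) * (6 * r))).
    by rewrite ler_wpM2l ?mulr_ge0//; lra.
  by rewrite rr le_eqVlt; apply/orP; left; apply/eqP; ring.
have {}hW : \sum_(i < n) \sum_(j < n) (Mhat i j - M i j) ^+ 2 <=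
    (36 / eta ^+ 2 + 1) * d + (36 / eta + 12) * (K * r ^+ 3).
  apply: le_trans hle _; apply: le_trans hW _; rewrite mulrDr.
  apply: (@le_trans _ _ (36 / eta ^+ 2 * d + 36 / eta * (K * r ^+ 3) + (12 * (K * r ^+ 3) + d))).
    by rewrite !lerD.
  by rewrite le_eqVlt; apply/orP; left; apply/eqP; ring.
rewrite /mse; apply: (@le_trans _ _ ((n%:R ^+ 2)^-1 * ((36 / eta ^+ 2 + 1) * d + (36 / eta + 12) * (K * r ^+ 3)))).
  by rewrite ler_wpM2l ?invr_ge0 ?sqr_ge0.
rewrite -/r rr le_eqVlt; apply/orP; left; apply/eqP; field.
by rewrite !gt_eqF.
Qed.

End Deterministic.

Section Pattern.
Variables (R : realType) (n : nat).

(** Forced to be false off the upper triangle, so as to lie in [upper_patterns]. *)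
Definition pattern_of (A : 'M[R]_n) : pattern n :=
  [ffun e : 'I_n * 'I_n => (e.1 < e.2)%N && (A e.1 e.2 == 1)].

Lemma pattern_of_upper A : pattern_of A \in @upper_patterns n.
Proof.
apply/pfamilyP; split=> //; apply/fintype.subsetP => e; rewrite !inE ffunE.
by rewrite unfold_in; case: (e.1 < e.2)%N.
Qed.

Lemma pattern_ofE A (i j : 'I_n) : adjacency_matrix A -> (i < j)%N ->
  A i j = (pattern_of A (i, j))%:R.
Proof.
move=> [A01 _ _] ij; rewrite ffunE /= ij /=.
by have [->|->] := A01 i j; rewrite ?eqxx// eq_sym oner_eq0.
Qed.

(* The diagonal of [A] vanishes, so removing that of [M] costs at most 1. *)
Lemma op_bound_adjacency (A M : 'M[R]_n) b : adjacency_matrix A -> M^T = M ->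
  (forall i j, 0 <= M i j <= 1) ->
  op_bound (noise_mx (pattern_of A) M) b -> op_bound (A - M) (b + 1).
Proof.
move=> hA Msym hM hb.
have -> : A - M = noise_mx (pattern_of A) M + - diag_mx (\row_i M i i).
  have MC i j : M i j = M j i by rewrite -{1}Msym mxE.
have [_ AC A0] := hA; apply/matrixP => i j; rewrite !mxE.
  case: ltngtP => ij.
  - by rewrite -pattern_ofE// -val_eqE /= (ltn_eqF ij) subr0.
  - by rewrite -pattern_ofE// -val_eqE /= (gtn_eqF ij) subr0 AC MC.
  - by rewrite (val_inj ij) eqxx A0 !sub0r.
apply: op_boundD => //; apply/op_boundN/op_bound_diag => // i.
by rewrite mxE; have /andP[? ?] := hM i i; rewrite ger0_norm.
Qed.

End Pattern.

(** The integral of a nonnegative function is a supremum over the simple functions below it, hence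
    monotone for arbitrary functions. This serves for the loss, as [usvt] is only specified
    pointwise. *)
Lemma le_integral_nonneg d (T : measurableType d) (R : realType)
    (mu : {measure set T -> \bar R}) (f1 f2 : T -> \bar R) :
  (forall x, 0 <= f1 x)%E -> (forall x, f1 x <= f2 x)%E ->
  (\int[mu]_x f1 x <= \int[mu]_x f2 x)%E.
Proof.
move=> f10 f12; have f20 x : (0 <= f2 x)%E := le_trans (f10 x) (f12 x).
rewrite !ge0_integralTE//; apply: le_ereal_sup => _ [h /= hf <-].
by exists h => //= x; apply: le_trans (f12 x).
Qed.

(** * Expected loss over the random graph *)

Section Risk.
Context (R : realType) (eta : R) (heta : 0 < eta < 1) (f : R * R -> R) (hf : graphon f).
Context d (T : measurableType d) (P : probability T R) (n : nat)
  (U : 'I_n -> {RV P >-> R}) (X : T -> 'M[R]_n) (usvt : 'M[R]_n -> 'M[R]_n).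
Hypothesis n_gt0 : (0 < n)%N.
Hypothesis hU : iid_uniform U.
Hypothesis hX : graphon_random_graph f U X.
Hypothesis husvt : usvt_estimator eta usvt.

Local Notation M w := (mean_matrix f (fun i => U i : T -> R) w).

Let loss w : R := (n%:R ^+ 2)^-1 *
  \sum_(i < n) \sum_(j < n) (usvt (X w) i j - M w i j) ^+ 2.

Let MSE_loss : MSE P (fun w => usvt (X w)) (mean_matrix f (fun i => U i : T -> R)) =
  (\int[P]_w (loss w)%:E)%E.
Proof. by rewrite /MSE unlock. Qed.

Let M01 w i j : 0 <= M w i j <= 1. Proof. exact: mean_matrix_itv. Qed.

Let loss_ge0 w : 0 <= loss w.
Proof.
rewrite /loss mulr_ge0 ?invr_ge0 ?sqr_ge0//.
by do 2![apply: sumr_ge0 => ? _]; rewrite sqr_ge0.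
Qed.

Let loss_le4 w : loss w <= 4.
Proof. exact: (usvt_error_le4 n_gt0 (M01 w) (husvt (X w))). Qed.

Lemma MSE_ge0 :
  (0 <= MSE P (fun w => usvt (X w)) (mean_matrix f (fun i => U i : T -> R)))%E.
Proof. by rewrite MSE_loss; apply: integral_ge0 => w _; rewrite lee_fin. Qed.

Lemma MSE_le4 :
  (MSE P (fun w => usvt (X w)) (mean_matrix f (fun i => U i : T -> R)) <= 4%:E)%E.
Proof.
rewrite MSE_loss; apply: (@le_trans _ _ (\int[P]_w 4%:E)%E).
  by apply: le_integral_nonneg => w; rewrite lee_fin.
by rewrite integral_cst// [X in (_ * X)%E](@probability_setT _ _ _ P) mule1.
Qed.

Section Approximation.
Variables (K : R) (g : R * R -> R).
Hypothesis Kg : rect_span K g.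
Hypothesis n_large : 4 <= n%:R * eta ^+ 2.

Let c1 : R := 36 / eta ^+ 2 + 1.
Let c2 : R := 36 / eta + 12.
Let h (x : R * R) : R := (graphon_ext f x - g x) ^+ 2.
Let avg w : R := (n%:R ^+ 2)^-1 * \sum_(i < n) \sum_(j < n) h (U i w, U j w).

(** If the noise is small, the deterministic bound applies. Otherwise [w] lies in some noise event,
    whose indicator times 4 pays for the trivial bound on the loss. *)
Lemma loss_le w :
  ((loss w)%:E <= c1%:E * (avg w)%:E + ((c2 * K / Num.sqrt n%:R)%:E +
     4%:E * \sum_(a in @upper_patterns n) \sum_e \sum_v (\1_(noise_event f U X a e v) w)%:E))%E.
Proof.
have [hadj _ _] := hX; have /andP[eta0 eta1] := heta.
have K0 := rect_span_ge0 Kg.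
have c1_ge0 : 0 <= c1 by rewrite addr_ge0// divr_ge0// sqr_ge0.
have c2_ge0 : 0 <= c2 by rewrite addr_ge0// divr_ge0// ltW.
have avg0 : 0 <= avg w.
  rewrite mulr_ge0 ?invr_ge0 ?sqr_ge0//.
  by do 2![apply: sumr_ge0 => ? _]; rewrite sqr_ge0.
have cK0 : 0 <= c2 * K / Num.sqrt n%:R by rewrite divr_ge0 ?sqrtr_ge0// mulr_ge0.
have ind0 a e v : (0 <= (\1_(noise_event f U X a e v) w : R)%:E)%E by rewrite lee_fin.
pose a0 := pattern_of (X w).
have [hb|hb] := pselect (op_bound (noise_mx a0 (M w)) (2 * Num.sqrt n%:R)).
  pose B : 'M[R]_n := \matrix_(i, j) g (U i w, U j w).
  have hAM := op_bound_adjacency (hadj w) (mean_matrix_sym hf hU w) (M01 w) hb.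
  have := usvt_error_le n_gt0 heta (M01 w) (husvt (X w)) K0 n_large hAM
    (rect_span_nuclear (fun i => U i w) (fun j => U j w) Kg).
  rewrite fdot_sqr -/(loss w) -/c1 -/c2.
  have -> : \sum_i \sum_j (M w - \matrix_(i, j) g (U i w, U j w)) i j ^+ 2 =
      \sum_(i < n) \sum_(j < n) h (U i w, U j w).
    by apply: eq_bigr => i _; apply: eq_bigr => j _; rewrite mxE (mean_matrixE f hU) !mxE.
  move=> hl; rewrite addeA -EFinM -EFinD; apply: (@le_trans _ _ (c1 * avg w + c2 * K / Num.sqrt n%:R)%:E).
    by rewrite lee_fin.
  by rewrite leeDl// mule_ge0// ?lee_fin//; do 3![apply: sume_ge0 => ? _].
(* The estimator is defined on every matrix, so applying it to the noise supplies the singular value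
   decomposition needed. *)
have [s [V1 [V2 [hsvd _]]]] := husvt (noise_mx a0 (M w)).
have [e [v hev]] := noise_exceeds n_gt0 hsvd hb.
have evw : w \in noise_event f U X a0 e v.
  apply/mem_set; split => //= i j ij; exact: pattern_ofE.
apply: (@le_trans _ _ (4%:E * (\1_(noise_event f U X a0 e v) w)%:E)%E).
  by rewrite indicE evw mule1 lee_fin.
apply: (@le_trans _ _ (4%:E * \sum_(a in @upper_patterns n) \sum_e \sum_v (\1_(noise_event f U X a e v) w)%:E)%E).
  apply: lee_wpmul2l; first by rewrite lee_fin.
  rewrite (bigD1 a0) ?pattern_of_upper//= (bigD1 e)//= (bigD1 v)//= -!addeA leeDl//.
  by rewrite !adde_ge0//; do ?[apply: sume_ge0 => ? _].
by rewrite addeA leeDr// -EFinM -EFinD lee_fin addr_ge0// mulr_ge0.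
Qed.

Lemma MSE_le e : (\int[(unif_law R \x unif_law R)%E]_x (h x)%:E <= e%:E)%E ->
  (MSE P (fun w => usvt (X w)) (mean_matrix f (fun i => U i : T -> R)) <=
   (c1 * (e + (1 + K) ^+ 2 / n%:R) + (c2 * K / Num.sqrt n%:R + 8 * (199 / 200) ^+ n))%:E)%E.
Proof.
move=> he; have /andP[eta0 eta1] := heta.
have K0 := rect_span_ge0 Kg.
have c1_ge0 : 0 <= c1 by rewrite addr_ge0// divr_ge0// sqr_ge0.
have c2_ge0 : 0 <= c2 by rewrite addr_ge0// divr_ge0// ltW.
have cK0 : 0 <= c2 * K / Num.sqrt n%:R by rewrite divr_ge0 ?sqrtr_ge0// mulr_ge0.
have mh : measurable_fun setT h.
  by apply: measurable_funX; apply: measurable_funB (rect_span_measurable Kg); exact: measurable_graphon_ext.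
(* The graphon is at most 1 and [g] at most [K] in absolute value. *)
have h0c x : 0 <= h x <= (1 + K) ^+ 2.
  rewrite sqr_ge0 /h -[leLHS]real_normK ?num_real//= lerXn2r ?nnegrE ?addr_ge0//.
  apply: le_trans (ler_normB _ _) _; apply: lerD (rect_span_le _ Kg).
  by have /andP[? ?] := graphon_ext_itv hf x; rewrite ger0_norm.
have mavg : measurable_fun setT (fun w => (avg w)%:E).
  apply/measurable_EFinP; apply: measurable_funM => //.
  apply: measurable_sum => i; apply: measurable_sum => j.
  exact: measurableT_comp mh (measurable_pair U i j).
have avg0 w : (0 <= (avg w)%:E)%E.
  rewrite lee_fin mulr_ge0 ?invr_ge0 ?sqr_ge0//.
  by do 2![apply: sumr_ge0 => ? _]; rewrite sqr_ge0.
pose N w := (\sum_(a in @upper_patterns n) \sum_e \sum_v (\1_(noise_event f U X a e v) w : R)%:E)%E.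
have ind0 a e' v w : (0 <= (\1_(noise_event f U X a e' v) w : R)%:E)%E by rewrite lee_fin.
have mind a e' v : measurable_fun setT (fun w => (\1_(noise_event f U X a e' v) w : R)%:E).
  by apply/measurable_EFinP; apply: measurable_indic; exact: noise_event_measurable.
have N0 w : (0 <= N w)%E by do 3![apply: sume_ge0 => ? _].
have mN : measurable_fun setT N.
  rewrite /N; under eq_fun do rewrite -big_filter.
  by do 3![apply: emeasurable_sum => ?]; exact: mind.
have intN : (\int[P]_w N w <= (2 * (199 / 200) ^+ n)%:E)%E.
  apply: le_trans (noise_event_sum hf hU hX n_gt0).
  rewrite /N; under eq_integral do rewrite -big_filter.
  rewrite ge0_integral_sum//; last 2 first.
  - by move=> a; do 2![apply: emeasurable_sum => ?]; exact: mind.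
  - by move=> a w _; do 2![apply: sume_ge0 => ? _].
  rewrite big_filter; apply: lee_sum => a _.
  rewrite ge0_integral_sum//; last 2 first.
  - by move=> e'; apply: emeasurable_sum => v; exact: mind.
  - by move=> e' w _; apply: sume_ge0 => ? _.
  apply: lee_sum => e' _; rewrite ge0_integral_sum//.
  apply: lee_sum => v _.
  by rewrite integral_indic ?setIT//; exact: noise_event_measurable.
have intavg := expected_average hU n_gt0 mh h0c he.
rewrite MSE_loss; apply: (@le_trans _ _ (\int[P]_w (c1%:E * (avg w)%:E +
    ((c2 * K / Num.sqrt n%:R)%:E + 4%:E * N w)))%E).
  by apply: le_integral_nonneg => w; [rewrite lee_fin | exact: loss_le].
have m4N : measurable_fun setT (fun w => 4%:E * N w)%E by exact: measurable_funeM.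
have n4N w : (0 <= 4%:E * N w)%E by rewrite mule_ge0// lee_fin.
rewrite ge0_integralD//; last 4 first.
- by move=> w _; rewrite mule_ge0// lee_fin.
- exact: measurable_funeM.
- by move=> w _; rewrite adde_ge0// lee_fin.
- exact: emeasurable_funD.
rewrite ge0_integralD//.
rewrite integral_cst// [X in (_ * X + _)%E](@probability_setT _ _ _ P) mule1.
rewrite !ge0_integralZl//.
rewrite [leRHS](_ : _ = c1%:E * (e + (1 + K) ^+ 2 / n%:R)%:E +
  ((c2 * K / Num.sqrt n%:R)%:E + 4%:E * (2 * (199 / 200) ^+ n)%:E))%E; last first.
  by rewrite -!EFinM -!EFinD; congr (_%:E); ring.
by apply: leeD; [|apply: leeD => //]; apply: lee_wpmul2l => //; rewrite lee_fin.
Qed.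

End Approximation.
End Risk.

(** Uniform over all probability spaces, samples and versions of the estimator, so that a bound
    depends on [eta], [f] and [n] alone. *)
Definition risk_bound (R : realType) (eta : R) (f : R * R -> R) (n : nat) (c : R) : Prop :=
  forall (d : measure_display) (T : measurableType d) (P : probability T R)
    (U : 'I_n -> {RV P >-> R}) (X : T -> 'M[R]_n)
    (usvt : 'M[R]_n -> 'M[R]_n),
    iid_uniform U -> graphon_random_graph f U X -> usvt_estimator eta usvt ->
    (MSE P (fun w => usvt (X w))
           (mean_matrix f (fun i => U i : T -> R)) <= c%:E)%E.

(** Four terms of at most [e / 4] each. The approximation [g], and with it [K], is fixed first; the
    other three terms then vanish as [n] grows. *)
Lemma risk_bound_near (R : realType) (eta : R) (f : R * R -> R) (e : R) :
  0 < eta < 1 -> graphon f -> 0 < e ->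
  \forall n \near \oo, (0 < n)%N -> risk_bound eta f n e.
Proof.
move=> heta hf e0; have /andP[eta0 eta1] := heta.
pose c1 : R := 36 / eta ^+ 2 + 1; pose c2 : R := 36 / eta + 12.
have c1_gt0 : 0 < c1 by rewrite addr_gt0// divr_gt0// exprn_gt0.
have c2_gt0 : 0 < c2 by rewrite addr_gt0// divr_gt0.
have ec0 : 0 < e / 4 / c1 by rewrite !divr_gt0.
have [K [g [Kg gf]]] := rect_approx_bounded (unif_law R \x unif_law R)%E
  (measurable_graphon_ext hf) (graphon_ext_itv hf) ec0.
have K0 := rect_span_ge0 Kg.
have natoo (x : R) : \forall n \near \oo, x <= n%:R by exact: nbhs_infty_ger.
have geom_oo (q : R) : 0 <= q < 1 -> \forall n \near \oo, 8 * q ^+ n <= e / 4.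
  move=> /andP[q0 q1]; have q_lt1 : `|q| < 1 by rewrite ger0_norm.
  have e80 : 0 < 8^-1 * (e / 4) by rewrite mulr_gt0 ?invr_gt0// divr_gt0.
  have /cvgr0_norm_le/(_ _ e80) := cvg_expr q_lt1; apply: filterS => n.
  by rewrite ger0_norm ?exprn_ge0// ler_pdivlMl.
near=> n.
move=> n0 d T P U X usvt hU hX husvt.
have n0' : 0 < n%:R :> R by rewrite ltr0n.
have n_large : 4 <= n%:R * eta ^+ 2.
  rewrite -ler_pdivrMr; last by rewrite exprn_gt0.
  by near: n; exact: natoo.
apply: le_trans (MSE_le heta hf n0 hU hX husvt Kg n_large gf) _.
rewrite lee_fin -/c1 -/c2 mulrDr.
have b1 : c1 * (e / 4 / c1) <= e / 4 by rewrite mulrC divfK// gt_eqF.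
have b2 : c1 * ((1 + K) ^+ 2 / n%:R) <= e / 4.
  rewrite mulrA ler_pdivrMr// (mulrC (e / 4)) -ler_pdivrMr; last by rewrite divr_gt0.
  by near: n; exact: natoo.
have b3 : c2 * K / Num.sqrt n%:R <= e / 4.
  have sn0 : 0 < Num.sqrt n%:R :> R by rewrite sqrtr_gt0.
  rewrite ler_pdivrMr// (mulrC (e / 4)) -ler_pdivrMr; last by rewrite divr_gt0.
  have q0 : 0 <= c2 * K / (e / 4) by rewrite divr_ge0// ?mulr_ge0// ltW// divr_gt0.
  rewrite -[leLHS]ger0_norm// -sqrtr_sqr ler_wsqrtr//.
  by near: n; exact: natoo.
have b4 : 8 * (199 / 200) ^+ n <= e / 4 by near: n; apply: geom_oo; lra.
apply: (le_trans (lerD (lerD b1 b2) (lerD b3 b4))); rewrite le_eqVlt.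
by apply/orP; left; apply/eqP; field.
Unshelve. all: by end_near. Qed.

Theorem theorem2p10 (R : realType) (eta : R) (heta : 0 < eta < 1)
    (f : R * R -> R) (hf : graphon f) :
  exists C : nat -> R,
    (C n @[n --> \oo] --> (0 : R)) /\
    forall (n : nat), (0 < n)%N ->
    forall (d : measure_display) (T : measurableType d) (P : probability T R)
      (U : 'I_n -> {RV P >-> R}) (X : T -> 'M[R]_n)
      (usvt : 'M[R]_n -> 'M[R]_n),
      iid_uniform U ->
      graphon_random_graph f U X ->
      usvt_estimator eta usvt ->
      (MSE P (fun w => usvt (X w))
             (mean_matrix f (fun i => U i : T -> R)) <= (C n)%:E)%E.
Proof.
(* [C n] is the infimum of all nonnegative uniform bounds. Every [e > 0] is eventually such a bound,
   whence the limit 0; the value 4 always is one, so the set is nonempty. *)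
pose bounds n := [set c : R | 0 <= c /\ ((0 < n)%N -> risk_bound eta f n c)].
have bounds4 n : bounds n 4.
  split=> // n0 d T P U X usvt hU hX husvt; exact: (MSE_le4 hf X n0 hU husvt).
have lb0 n : lbound (bounds n) 0 by move=> c [].
exists (fun n => inf (bounds n)); split.
  apply/cvgrPdist_le => e e0; near=> n.
  rewrite sub0r normrN ger0_norm; last by apply: lb_le_inf; [exists 4|exact: lb0].
  apply: ge_inf; first by exists 0; exact: lb0.
  split; first exact: ltW.
  by near: n; exact: risk_bound_near.
move=> n n0 d T P U X usvt hU hX husvt.
have mse0 := MSE_ge0 f U X usvt.
have mse4 := MSE_le4 hf X n0 hU husvt.
(* The risk is finite and below every element of [bounds n], hence below the infimum. *)
rewrite -(@fineK _ (MSE _ _ _)) ?lee_fin; last first.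
  by rewrite ge0_fin_numE//; apply: le_lt_trans mse4 (ltry _).
apply: lb_le_inf; first by exists 4.
move=> c [_ hc]; rewrite -lee_fin fineK; first exact: hc.
by rewrite ge0_fin_numE//; apply: le_lt_trans mse4 (ltry _).
Unshelve. all: by end_near. Qed.
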